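(* Consider a quadrotor with a cable-suspended payload, with configuration $(x,R,q_1,\dots,q_n)\in\mathbb{R}^3\times\mathsf{SO(3)}\times(\mathsf{S}^2)^n$, whose Lagrangian is $L=T-V$ with $$T=\tfrac12 M_{00}\|\dot x\|^2+\dot x\cdot\sum_{i=1}^n M_{0i}\dot q_i+\tfrac12\sum_{i,j=1}^n M_{ij}\,\dot q_i\cdot\dot q_j+\tfrac12\Omega^TJ\Omega,$$ $$V=-\sum_{i=1}^n\sum_{a=i}^n m_a g l_i\, e_3\cdot q_i-M_{00}g\,e_3\cdot x,$$ subject to the external force $-fRe_3+\Delta_x$ and the external moment $M+\Delta_R$. The Euler-Lagrange equations on $\mathbb{R}^3\times\mathsf{SO(3)}\times(\mathsf{S}^2)^n$ are $$M_{00}\ddot x+\sum_{i=1}^n M_{0i}\ddot q_i=-fRe_3+M_{00}ge_3+\Delta_x,\qquad(\mathrm{a})$$ $$M_{ii}\ddot q_i-\hat q_i^2\Big(M_{i0}\ddot x+\sum_{j=1,\,j\neq i}^n M_{ij}\ddot q_j\Big)=-M_{ii}\|\dot q_i\|^2q_i-\sum_{a=i}^n m_a g l_i\,\hat q_i^2e_3,\quad i=1,\dots,n,\qquad(\mathrm{b})$$ $$J\dot\Omega+\hat\Omega J\Omega=M+\Delta_R.\qquad(\mathrm{c})$$ Equations (a) and (b) can be rewritten in matrix form as $$\begin{bmatrix}M_{00}&M_{01}&M_{02}&\cdots&M_{0n}\\-\hat q_1^2M_{10}&M_{11}I_3&-M_{12}\hat q_1^2&\cdots&-M_{1n}\hat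 q_1^2\\-\hat q_2^2M_{20}&-M_{21}\hat q_2^2&M_{22}I_3&\cdots&-M_{2n}\hat q_2^2\\\vdots&\vdots&\vdots&&\vdots\\-\hat q_n^2M_{n0}&-M_{n1}\hat q_n^2&-M_{n2}\hat q_n^2&\cdots&M_{nn}I_3\end{bmatrix}\begin{bmatrix}\ddot x\\\ddot q_1\\\ddot q_2\\\vdots\\\ddot q_n\end{bmatrix}=\begin{bmatrix}-fRe_3+M_{00}ge_3+\Delta_x\\-\|\dot q_1\|^2M_{11}q_1-\sum_{a=1}^n m_agl_1\hat q_1^2e_3\\-\|\dot q_2\|^2M_{22}q_2-\sum_{a=2}^n m_agl_2\hat q_2^2e_3\\\vdots\\-\|\dot q_n\|^2M_{nn}q_n-m_ngl_n\hat q_n^2e_3\end{bmatrix}.$$ Or equivalently, in terms of the angular velocities $\omega_i$ of the links, $$\begin{bmatrix}M_{00}&-M_{01}\hat q_1&-M_{02}\hat q_2&\cdots&-M_{0n}\hat q_n\\\hat q_1M_{10}&M_{11}I_3&-M_{12}\hat q_1\hat q_2&\cdots&-M_{1n}\hat q_1\hat q_n\\\hat q_2M_{20}&-M_{21}\hat q_2\hat q_1&M_{22}I_3&\cdots&-M_{2n}\hat q_2\hat q_n\\\vdots&\vdots&\vdots&&\vdots\\\hat q_nM_{n0}&-M_{n1}\hat q_n\hat q_1&-M_{n2}\hat q_n\hat q_2&\cdots&M_{nn}I_3\end{bmatrix}\begin{bmatrix}\ddot x\\\dot\omega_1\\\dot\omega_2\\\vdots\\\dot\omega_n\end{bmatrix}=\begin{bmatrix}\sum_{j=1}^nM_{0j}\|\omega_j\|^2q_j-fRe_3+M_{00}ge_3+\Delta_x\\\sum_{j=2}^nM_{1j}\|\omega_j\|^2\hat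 q_1q_j+\sum_{a=1}^nm_agl_1\hat q_1e_3\\\sum_{j=1,j\ne2}^nM_{2j}\|\omega_j\|^2\hat q_2q_j+\sum_{a=2}^nm_agl_2\hat q_2e_3\\\vdots\\\sum_{j=1}^{n-1}M_{nj}\|\omega_j\|^2\hat q_nq_j+m_ngl_n\hat q_ne_3\end{bmatrix},$$ $$\dot q_i=\omega_i\times q_i,\quad i=1,\dots,n.$$
   Context: A quadrotor carries a payload through a chain of $n$ serially connected links. $e_1,e_2,e_3$ is the standard basis of $\mathbb{R}^3$ (inertial frame), with $e_3$ in the direction of gravity; $g$ is the gravitational acceleration. $x\in\mathbb{R}^3$ is the position of the quadrotor's mass center; $R\in\mathsf{SO(3)}=\{R\in\mathbb{R}^{3\times3}: R^TR=I,\ \det R=1\}$ is its attitude (body-fixed to inertial frame); $m$ and $J\in\mathbb{R}^{3\times3}$ are its mass and inertia matrix; $\Omega\in\mathbb{R}^3$ is its angular velocity in the body-fixed frame. $q_i\in\mathsf{S}^2=\{q\in\mathbb{R}^3:\|q\|=1\}$ is the direction of the $i$-th link, measured outward from the quadrotor toward the payload; $m_i,l_i$ are the mass and length of the $i$-th link (mass concentrated at its outboard end; the first link is attached at the quadrotor's mass center), so that mass $m_i$ is at $x_i=x+\sum_{a=1}^i l_aq_a$ and $m_n$ is the payload mass. $\omega_i\in\mathbb{R}^3$ is the angular velocity of the $i$-th link in the inertial frame, with $q_i\cdot\omega_i=0$. The kinematics are $\dot R=R\hat\Omega$ and $\dot q_i=\omega_i\times q_i=\hat\omega_iq_i$, where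 the hat map $\hat\cdot:\mathbb{R}^3\to\mathfrak{so}(3)$ is defined by $\hat xy=x\times y$ for all $x,y\in\mathbb{R}^3$. The inertia constants are, for $1\le i,j\le n$, $$M_{00}=m+\sum_{i=1}^nm_i,\quad M_{0i}=M_{i0}=\sum_{a=i}^nm_al_i,\quad M_{ij}=\Big(\sum_{a=\max\{i,j\}}^nm_a\Big)l_il_j .$$ In block matrices acting on $\mathbb{R}^3$ blocks, a scalar entry such as $M_{00}$ or $M_{0i}$ means that scalar times $I_3$. The control inputs are the total thrust magnitude $f\in\mathbb{R}$ (the thrust vector is $-fRe_3$ in the inertial frame) and the moment $M\in\mathbb{R}^3$ in the body-fixed frame. $\Delta_x,\Delta_R\in\mathbb{R}^3$ are fixed disturbances applied to the translational and rotational dynamics of the quadrotor, respectively. Euler-Lagrange equations are understood in the sense of the Lagrange-d'Alembert principle: the variation of the action integral $\int_{t_0}^{t_f}L\,dt$ equals the negative of the virtual work $\int_{t_0}^{t_f}\{(-fRe_3+\Delta_x)\cdot\delta x+(M+\Delta_R)\cdot\eta\}\,dt$, for all variations vanishing at the end points, of the form $\delta x\in\mathbb{R}^3$, $\delta R=R\hat\eta$ with $\eta\in\mathbb{R}^3$ (so $\delta\Omega=\dot\eta+\Omega\times\eta$), and $\delta q_i=\xi_i\times q_i$ with $\xi_i\in\mathbb{R}^3$, $\xi_i\cdot q_i=0$. *)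

(* Defs.v *)
From HB Require Import structures.
From mathcomp Require Import all_boot all_order all_algebra.
From mathcomp Require Import all_classical all_reals all_analysis.

Set Implicit Arguments.
Unset Strict Implicit.
Unset Printing Implicit Defensive.

Import Order.TTheory GRing.Theory Num.Theory.
Import numFieldNormedType.Exports.

Local Open Scope classical_set_scope.
Local Open Scope ring_scope.

Notation vec3 R := 'cV[R]_3.
Notation mat3 R := 'M[R]_3.

Definition dot {R : realType} (u v : vec3 R) : R := \sum_k u k 0 * v k 0.

(* The norm of MathComp-Analysis on matrices is the sup norm, hence this one. *)
Definition enorm {R : realType} (u : vec3 R) : R := Num.sqrt (dot u u).

(* The index k + 1 is taken modulo 3 in 'I_3. *)
Definition cross {R : realType} (u v : vec3 R) : vec3 R :=
  \col_(k < 3) (u (k + 1) 0 * v (k + 2) 0 - u (k + 2) 0 * v (k + 1) 0).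

Definition hat {R : realType} (u : vec3 R) : mat3 R :=
  \matrix_(i < 3, j < 3) cross u (delta_mx j 0) i 0.

Lemma hatE (R : realType) (u v : vec3 R) : hat u *m v = cross u v.
Proof.
apply/colP => i; rewrite !mxE.
rewrite (eq_bigr (fun j : 'I_3 => u (i + 1) 0 * (v j 0 *+ (i + 2 == j))
    - u (i + 2) 0 * (v j 0 *+ (i + 1 == j)))); last first.
  by move=> j _; rewrite !mxE eqxx !andbT mulrBl -!mulrA !mulr_natl.
rewrite sumrB -!mulr_sumr; congr (_ * _ - _ * _).
  by rewrite (bigD1 (i + 2)) //= eqxx big1 ?addr0 // => j /negPf;
     rewrite eq_sym => ->.
by rewrite (bigD1 (i + 1)) //= eqxx big1 ?addr0 // => j /negPf;
   rewrite eq_sym => ->.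
Qed.

Definition e3 {R : realType} : vec3 R := delta_mx ord_max 0.

Definition SO3 {R : realType} : set (mat3 R) :=
  [set A | A^T *m A = 1%:M /\ \det A = 1].

Definition S2 {R : realType} : set (vec3 R) := [set q | enorm q = 1].

Record parameters (R : realType) (n : nat) := MkParameters {
  mass : R;
  inertia : mat3 R;
  link_mass : 'I_n -> R;
  link_length : 'I_n -> R;
  gravity : R }.

(* Links are numbered from 0 to n - 1: link i here is link i + 1 of the usual
   numbering 1, ..., n, the index 0 of the inertia constants being kept for the
   quadrotor. *)
Definition M00 {R : realType} {n : nat}
    (P : parameters R n) : R := mass P + \sum_i link_mass P i.

Definition M0 {R : realType} {n : nat} (P : parameters R n) (i : 'I_n) : R :=
  \sum_(a < n | (i <= a)%N) link_mass P a * link_length P i.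

Definition Mij {R : realType} {n : nat} (P : parameters R n) (i j : 'I_n) : R :=
  (\sum_(a < n | (maxn i j <= a)%N) link_mass P a)
    * link_length P i * link_length P j.

Definition link_weight {R : realType} {n : nat}
    (P : parameters R n) (i : 'I_n) : R :=
  \sum_(a < n | (i <= a)%N) link_mass P a * gravity P * link_length P i.

Record motion (R : realType) (n : nat) := Motion {
  pos : R -> vec3 R;
  att : R -> mat3 R;
  angvel : R -> vec3 R;
  dir : 'I_n -> R -> vec3 R }.

Definition kinetic_energy {R : realType} {n : nat} (P : parameters R n)
    (vx Om : vec3 R) (vq : 'I_n -> vec3 R) : R :=
  2^-1 * M00 P * enorm vx ^+ 2 + dot vx (\sum_i M0 P i *: vq i)
  + 2^-1 * (\sum_i \sum_j Mij P i j * dot (vq i) (vq j))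
  + 2^-1 * dot Om (inertia P *m Om).

Definition potential_energy {R : realType} {n : nat} (P : parameters R n)
    (x : vec3 R) (q : 'I_n -> vec3 R) : R :=
  - (\sum_i link_weight P i * dot e3 (q i)) - M00 P * gravity P * dot e3 x.

Definition lagrangian {R : realType} {n : nat}
    (P : parameters R n) (s : motion R n) (t : R) : R :=
  kinetic_energy P (derive1 (pos s) t) (angvel s t)
    (fun i => derive1 (dir s i) t)
  - potential_energy P (pos s t) (fun i => dir s i t).

Definition action {R : realType} {n : nat}
    (P : parameters R n) (t0 tf : R) (s : motion R n) : R :=
  \int[lebesgue_measure]_(t in `[t0, tf]) lagrangian P s t.

Definition C1 {R : realType} {V : normedModType R}
    (D : set R) (c : R -> V) : Prop :=
  forall t, D t -> derivable c t 1 /\ {for t, continuous (derive1 c)}.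

Definition C2 {R : realType} {V : normedModType R}
    (D : set R) (c : R -> V) : Prop :=
  C1 D c /\ C1 D (derive1 c).

Definition d_eps {R : realType} {V : normedModType R}
    (u : R -> R -> V) : R -> R -> V :=
  fun e t => derive1 (u ^~ t) e.

Definition d_time {R : realType} {V : normedModType R}
    (u : R -> R -> V) : R -> R -> V :=
  fun e t => derive1 (u e) t.

(* Class C^1 jointly in both variables, on the product E `*` D. *)
Definition jointC1 {R : realType} {V : normedModType R}
    (E D : set R) (u : R -> R -> V) : Prop :=
  forall e t, E e -> D t ->
    [/\ derivable (u ^~ t) e 1, derivable (u e) t 1,
        {for (e, t), continuous (fun p : R * R => d_eps u p.1 p.2)} &
        {for (e, t), continuous (fun p : R * R => d_time u p.1 p.2)}].

Definition jointC2 {R : realType} {V : normedModType R}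
    (E D : set R) (u : R -> R -> V) : Prop :=
  [/\ jointC1 E D u, jointC1 E D (d_eps u) & jointC1 E D (d_time u)].

(* The motion takes its values in R^3 x SO(3) x (S^2)^n during the time set D,
   and angvel is the body-fixed angular velocity of the attitude. *)
Definition on_configuration_space {R : realType} {n : nat}
    (D : set R) (s : motion R n) : Prop :=
  forall t, D t ->
    [/\ SO3 (att s t), forall i, S2 (dir s i t)
      & derive1 (att s) t = att s t *m hat (angvel s t)].

(* One-parameter family of motions V e, |e| < r, with V 0 = s. *)
Definition is_variation {R : realType} {n : nat}
    (D : set R) (r : R) (s : motion R n)
    (V : R -> motion R n) : Prop :=
  let E := [set e : R | `|e| < r] in
  [/\ 0 < r, V 0 = s, forall e, E e -> on_configuration_space D (V e) &
      [/\ jointC2 E D (fun e => pos (V e)), jointC2 E D (fun e => att (V e))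
        & forall i, jointC2 E D (fun e => dir (V e) i)]].

Definition delta_pos {R : realType} {n : nat}
    (V : R -> motion R n) (t : R) : vec3 R :=
  d_eps (fun e => pos (V e)) 0 t.

Definition delta_att {R : realType} {n : nat}
    (V : R -> motion R n) (t : R) : mat3 R :=
  d_eps (fun e => att (V e)) 0 t.

Definition delta_dir {R : realType} {n : nat}
    (V : R -> motion R n) (i : 'I_n) (t : R) : vec3 R :=
  d_eps (fun e => dir (V e) i) 0 t.

Definition thrust {R : realType} {n : nat}
    (f : R -> R) (s : motion R n) (t : R) : vec3 R :=
  - (f t *: (att s t *m e3)).

Definition virtual_work {R : realType} {n : nat}
    (f : R -> R) (M : R -> vec3 R) (Dx DR : vec3 R)
    (t0 tf : R) (s : motion R n) (dx eta : R -> vec3 R) : R :=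
  \int[lebesgue_measure]_(t in `[t0, tf])
    (dot (thrust f s t + Dx) (dx t) + dot (M t + DR) (eta t)).

(* The variation of the action integral is the derivative at e = 0 of the action
   along a family V of admissible motions; delta_pos, eta and xi are the
   infinitesimal variations that V generates, and only these are required to
   vanish at the end points. *)
Definition lagrange_dAlembert {R : realType} {n : nat}
    (P : parameters R n) (f : R -> R)
    (M : R -> vec3 R) (Dx DR : vec3 R) (D : set R) (t0 tf : R)
    (s : motion R n) : Prop :=
  forall (r : R) (V : R -> motion R n) (eta : R -> vec3 R)
      (xi : 'I_n -> R -> vec3 R),
    is_variation D r s V ->
    (forall t, D t -> delta_att V t = att s t *m hat (eta t)) ->
    (forall i t, D t ->
       delta_dir V i t = cross (xi i t) (dir s i t) /\
       dot (xi i t) (dir s i t) = 0) ->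
    (forall t, t = t0 \/ t = tf ->
       [/\ delta_pos V t = 0, eta t = 0 & forall i, xi i t = 0]) ->
    is_derive (0 : R) (1 : R) (fun e => action P t0 tf (V e))
      (- virtual_work f M Dx DR t0 tf s (delta_pos V) eta).

(* Main.v *)
Require Import Defs.
From HB Require Import structures.
From mathcomp Require Import all_boot all_order all_algebra.
From mathcomp Require Import all_classical all_reals all_analysis.
From mathcomp Require Import ring lra.
Set Implicit Arguments.
Unset Strict Implicit.
Unset Printing Implicit Defensive.

Import Order.TTheory GRing.Theory Num.Theory.
Import numFieldNormedType.Exports.

Local Open Scope classical_set_scope.
Local Open Scope ring_scope.

(** Write the equations of motion with everything on one side.  This gives a
    residual A for the quadrotor, a residual B_i for each link (before it is
    projected on the plane tangent to the sphere) and a residual C for the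
    attitude.  Everything follows from the formula of [first_variation]: along
    any admissible family of motions with variations dx, eta and dq_i that
    vanish at the end points, the derivative of the action is

      - (virtual work) - the integral of A . dx + sum_i B_i . dq_i + C . eta.

    To obtain it, differentiate under the integral sign.  The integrand then
    contains the variations of the velocities.  Those of x' and q_i' are the
    time derivatives of dx and dq_i because mixed partial derivatives commute
    ([schwarz]); that of the angular velocity is eta' + Om x eta because hat
    turns cross products into commutators.  Hence the integrand differs from
    the time derivative of the pairing of the momenta with the variations only
    by the virtual work and the residuals, which is the algebraic identity
    [dlagr_by_parts], and the integral of that time derivative vanishes.

    By the first variation formula, the Lagrange-d'Alembert principle says that
    the integral of A . dx + sum_i B_i . dq_i + C . eta is zero for all
    variations.  Since dq_i = xi_i x q_i, the link term is xi_i . (q_i x B_i).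
    So the principle holds when A, C and all q_i x B_i vanish.  Conversely
    ([stationary_tested]), translate the quadrotor by e phi(t) a and rotate its
    attitude and the links by the angle e phi(t) about fixed axes v and w_i.
    The principle gives that phi times a . A + v . C + sum_i w_i . (q_i x B_i)
    has integral 0 for all functions phi of class C^2 that vanish at the end
    points, so that sum vanishes ([fundamental_lemma]), for all a and for all
    v and w_i that are unit vectors or 0.

    What remains is algebra in each link.  On the unit sphere
    q . q'' = - |q'|^2, which makes q_i x B_i = 0 equivalent to the second-order
    equation of the link ([link_equationP]).  With q_i' = omega_i x q_i one has
    q_i'' = - q_i x omega_i' - |omega_i|^2 q_i and q_i x q_i'' = omega_i', so
    q_i x B_i is also the difference of the two sides of the row of omega_i
    ([link_row_omega]).  Both block systems are these rows, together with the
    row A = 0. *)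

(** * Vector algebra in three dimensions *)

Section VectorAlgebra.
Variable R : realType.
Implicit Types (u v w : vec3 R) (A B : mat3 R).

(** The indices are enumerated by the ring numerals, because [cross] is defined
    by addition modulo 3. *)
Lemma ord3P (Q : 'I_3 -> Prop) : Q 0 -> Q 1 -> Q 2%:R -> forall i, Q i.
Proof.
move=> Q0 Q1 Q2 [[|[|[|//]]] lti].
- by rewrite (_ : Ordinal _ = 0) //; exact/val_inj.
- by rewrite (_ : Ordinal _ = 1) //; exact/val_inj.
- by rewrite (_ : Ordinal _ = 2%:R) //; exact/val_inj.
Qed.

Lemma vec3P u v :
  u 0 0 = v 0 0 -> u 1 0 = v 1 0 -> u 2%:R 0 = v 2%:R 0 -> u = v.
Proof. by move=> h0 h1 h2; apply/colP; exact: ord3P. Qed.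

Lemma sum3E (V : nmodType) (F : 'I_3 -> V) : \sum_k F k = F 0 + F 1 + F 2%:R.
Proof.
rewrite 3!big_ord_recl big_ord0 addr0 addrA.
by congr (F _ + F _ + F _); exact/val_inj.
Qed.

Lemma dotE u v :
  dot u v = u 0 0 * v 0 0 + u 1 0 * v 1 0 + u 2%:R 0 * v 2%:R 0.
Proof. by rewrite /dot sum3E. Qed.

Lemma crossE u v :
  [/\ cross u v 0 0 = u 1 0 * v 2%:R 0 - u 2%:R 0 * v 1 0,
      cross u v 1 0 = u 2%:R 0 * v 0 0 - u 0 0 * v 2%:R 0 &
      cross u v 2%:R 0 = u 0 0 * v 1 0 - u 1 0 * v 0 0].
Proof.
have e i j (h : i = j) (w : vec3 R) : w i 0 = w j 0 by rewrite h.
by split; rewrite mxE; congr (_ * _ - _ * _); apply: e; exact/val_inj.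
Qed.

Lemma cross0E u v : cross u v 0 0 = u 1 0 * v 2%:R 0 - u 2%:R 0 * v 1 0.
Proof. by have [] := crossE u v. Qed.
Lemma cross1E u v : cross u v 1 0 = u 2%:R 0 * v 0 0 - u 0 0 * v 2%:R 0.
Proof. by have [] := crossE u v. Qed.
Lemma cross2E u v : cross u v 2%:R 0 = u 0 0 * v 1 0 - u 1 0 * v 0 0.
Proof. by have [] := crossE u v. Qed.

Definition coordE := (dotE, cross0E, cross1E, cross2E).

Lemma dotC u v : dot u v = dot v u.
Proof. by rewrite !dotE; ring. Qed.
Lemma dotDl u v w : dot (u + v) w = dot u w + dot v w.
Proof. by rewrite !dotE !mxE; ring. Qed.
Lemma dotDr u v w : dot u (v + w) = dot u v + dot u w.
Proof. by rewrite !dotE !mxE; ring. Qed.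
Lemma dotZl a u v : dot (a *: u) v = a * dot u v.
Proof. by rewrite !dotE !mxE; ring. Qed.
Lemma dotZr a u v : dot u (a *: v) = a * dot u v.
Proof. by rewrite !dotE !mxE; ring. Qed.
Lemma dotNl u v : dot (- u) v = - dot u v.
Proof. by rewrite !dotE !mxE; ring. Qed.
Lemma dot0l u : dot 0 u = 0.
Proof. by rewrite !dotE !mxE; ring. Qed.
Lemma dot0r u : dot u 0 = 0.
Proof. by rewrite !dotE !mxE; ring. Qed.

Lemma dot_suml (I : finType) (Q : pred I) (F : I -> vec3 R) v :
  dot (\sum_(i | Q i) F i) v = \sum_(i | Q i) dot (F i) v.
Proof.
by apply: (big_morph (dot ^~ v)) => [x y|]; [exact: dotDl|exact: dot0l].
Qed.
Lemma dot_sumr (I : finType) (Q : pred I) (F : I -> vec3 R) v :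
  dot v (\sum_(i | Q i) F i) = \sum_(i | Q i) dot v (F i).
Proof.
by apply: (big_morph (dot v)) => [x y|]; [exact: dotDr|exact: dot0r].
Qed.

Lemma dot_mulmxl A u v : dot (A *m u) v = dot u (A^T *m v).
Proof. by rewrite !dotE !mxE !sum3E !mxE; ring. Qed.

Lemma dot_delta k u : dot (delta_mx k 0) u = u k 0.
Proof.
rewrite /dot (bigD1 k) //= mxE !eqxx mul1r big1 ?addr0 // => i /negPf ik.
by rewrite mxE ik mul0r.
Qed.

Lemma dot_eq0 u : (forall k, dot (delta_mx k 0) u = 0) -> u = 0.
Proof. by move=> h; apply/colP => k; rewrite mxE -[LHS]dot_delta. Qed.

Lemma enorm_sq u : enorm u ^+ 2 = dot u u.
Proof. by rewrite sqr_sqrtr // dotE -!expr2 !addr_ge0 // sqr_ge0. Qed.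

Lemma S2E u : S2 u -> dot u u = 1.
Proof. by rewrite -enorm_sq => ->; rewrite expr1n. Qed.

Lemma crossDr u v w : cross u (v + w) = cross u v + cross u w.
Proof. by apply: vec3P; rewrite !(coordE, mxE); ring. Qed.
Lemma crossDl u v w : cross (u + v) w = cross u w + cross v w.
Proof. by apply: vec3P; rewrite !(coordE, mxE); ring. Qed.
Lemma crossZr a u v : cross u (a *: v) = a *: cross u v.
Proof. by apply: vec3P; rewrite !(coordE, mxE); ring. Qed.
Lemma crossZl a u v : cross (a *: u) v = a *: cross u v.
Proof. by apply: vec3P; rewrite !(coordE, mxE); ring. Qed.
Lemma crossC u v : cross u v = - cross v u.
Proof. by apply: vec3P; rewrite !(coordE, mxE); ring. Qed.
Lemma cross0r u : cross u 0 = 0.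
Proof. by apply: vec3P; rewrite !(coordE, mxE); ring. Qed.
Lemma cross0l u : cross 0 u = 0.
Proof. by apply: vec3P; rewrite !(coordE, mxE); ring. Qed.

Lemma crossNr u v : cross u (- v) = - cross u v.
Proof. by apply: vec3P; rewrite !(coordE, mxE); ring. Qed.
Lemma crossvv u : cross u u = 0.
Proof. by apply: vec3P; rewrite !(coordE, mxE); ring. Qed.

Lemma cross_sumr (I : finType) (Q : pred I) u (F : I -> vec3 R) :
  cross u (\sum_(j | Q j) F j) = \sum_(j | Q j) cross u (F j).
Proof.
by apply: (big_morph (cross u)) => [y z|]; [exact: crossDr|exact: cross0r].
Qed.

Lemma cross_cross u v w : cross u (cross v w) = dot u w *: v - dot u v *: w.
Proof. by apply: vec3P; rewrite !(coordE, mxE); ring. Qed.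

Lemma dot_cross u v w : dot u (cross v w) = dot v (cross w u).
Proof. by rewrite !coordE; ring. Qed.

Lemma dot_crossl u v : dot u (cross u v) = 0.
Proof. by rewrite !coordE; ring. Qed.

Lemma mx3_eq A B : (forall u, A *m u = B *m u) -> A = B.
Proof.
move=> h; apply/matrixP => i j.
have := h (delta_mx j 0); rewrite -!colE => /colP/(_ i).
by rewrite !mxE.
Qed.

Lemma hatD u v : hat (u + v) = hat u + hat v.
Proof. by apply: mx3_eq => w; rewrite mulmxDl !hatE crossDl. Qed.
Lemma hatZ a u : hat (a *: u) = a *: hat u.
Proof. by apply: mx3_eq => w; rewrite -scalemxAl !hatE crossZl. Qed.
Lemma hat0 : hat (0 : vec3 R) = 0.
Proof. by apply: mx3_eq => w; rewrite mul0mx hatE cross0l. Qed.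

Lemma hat_tr u : (hat u)^T = - hat u.
Proof.
apply/matrixP => i j; elim/ord3P: i; elim/ord3P: j;
by rewrite 2![in LHS]mxE 2![in RHS]mxE !(coordE, mxE) /=; ring.
Qed.

(** The Jacobi identity.  It is the source of the term Om x eta in the variation
    of the angular velocity. *)
Lemma hat_comm u v : hat u *m hat v - hat v *m hat u = hat (cross u v).
Proof.
apply: mx3_eq => w; rewrite mulmxBl -!mulmxA !hatE.
by apply: vec3P; rewrite !(coordE, mxE); ring.
Qed.

Lemma hat_cube u : hat u *m (hat u *m hat u) = - (dot u u *: hat u).
Proof.
apply: mx3_eq => w; rewrite -!mulmxA mulNmx -scalemxAl !hatE.
by apply: vec3P; rewrite !(coordE, mxE); ring.
Qed.

Lemma hat_sqE u v : hat u ^+ 2 *m v = cross u (cross u v).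
Proof. by rewrite expr2 -mulmxA !hatE. Qed.

(** [vee] is the inverse of [hat] on skew-symmetric matrices. *)
Definition vee A : vec3 R := \col_(k < 3) A (k + 2%:R) (k + 1).

Lemma veeD A B : vee (A + B) = vee A + vee B.
Proof. by apply/colP => k; rewrite !mxE. Qed.

Lemma veeE A :
  [/\ vee A 0 0 = A 2%:R 1, vee A 1 0 = A 0 2%:R & vee A 2%:R 0 = A 1 0].
Proof. by split; rewrite mxE; congr (A _ _); exact/val_inj. Qed.

Lemma hatK u : vee (hat u) = u.
Proof.
have [h0 h1 h2] := veeE (hat u).
by apply: vec3P; rewrite ?h0 ?h1 ?h2 mxE !coordE !mxE /=; ring.
Qed.

Lemma det3E A : \det A =
  A 0 0 * (A 1 1 * A 2%:R 2%:R - A 1 2%:R * A 2%:R 1)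
  - A 0 1 * (A 1 0 * A 2%:R 2%:R - A 1 2%:R * A 2%:R 0)
  + A 0 2%:R * (A 1 0 * A 2%:R 1 - A 1 1 * A 2%:R 0).
Proof.
pose a (i j : nat) := A (inord i) (inord j).
have aE i j : A i j = a i j by rewrite /a !inord_val.
rewrite (expand_det_row _ 0) sum3E /cofactor !(expand_det_row _ 0).
rewrite !big_ord_recl !big_ord0 /cofactor !det_mx11 !mxE !aE /=.
rewrite /bump /= !add0n ?add1n /= ?addn0 /= ?exprS ?expr0; ring.
Qed.

(** The triple product of A w, A u and A v is det A times that of w, u and v;
    this is the same identity with w removed. *)
Lemma mul_cross A u v : A^T *m cross (A *m u) (A *m v) = \det A *: cross u v.
Proof. by apply: vec3P; rewrite det3E !(coordE, mxE, sum3E); ring. Qed.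

(** Rotations preserve cross products. *)
Lemma hat_mul_SO3 A u : SO3 A -> A *m hat (A^T *m u) = hat u *m A.
Proof.
case=> AA detA; have AAt : A *m A^T = 1%:M by exact: mulmx1C.
apply: mx3_eq => w; rewrite -!mulmxA !hatE.
have := mul_cross A (A^T *m u) w; rewrite detA scale1r mulmxA AAt mul1mx => <-.
by rewrite mulmxA AAt mul1mx.
Qed.

Lemma dot_mul_orth A u v : A^T *m A = 1%:M -> dot (A *m u) (A *m v) = dot u v.
Proof. by move=> AA; rewrite dot_mulmxl mulmxA AA mul1mx. Qed.

Lemma SO3M A B : SO3 A -> SO3 B -> SO3 (A *m B).
Proof.
move=> [AA dA] [BB dB]; split; last by rewrite det_mulmx dA dB mulr1.
by rewrite trmx_mul -mulmxA (mulmxA A^T) AA mul1mx.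
Qed.

End VectorAlgebra.

(** * Calculus of matrix-valued curves *)

Section MatrixCalculus.
Variable R : realType.

(** The norm of a matrix is the maximum of the norms of its entries, of which
    there are finitely many. *)
Lemma cvg_mxP (T : Type) (F : set_system T) {FF : Filter F} (m n : nat)
    (f : T -> 'M[R]_(m, n)) (M : 'M[R]_(m, n)) :
  f x @[x --> F] --> M <-> forall i j, f x i j @[x --> F] --> M i j.
Proof.
split=> [fM i j|fM].
  exact: (cvg_comp _ _ fM (@coord_continuous R m n i j M)).
apply/cvgrPdist_le => /= e e0; near=> x.
rewrite /Num.Def.normr/= mx_normrE (bigmax_le _ (ltW e0))//= => i _.
rewrite !mxE/=; move: i; near: x; apply: filter_forall => /= i.
exact: ((cvgrPdist_le _ _).1 (fM i.1 i.2)).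
Unshelve. all: by end_near. Qed.

Lemma cvg_bigsum (T : Type) (F : set_system T) {FF : Filter F}
    (V : normedModType R) (I : Type) (s : seq I) (Q : pred I)
    (f : I -> T -> V) (l : I -> V) :
  (forall i, f i x @[x --> F] --> l i) ->
  \sum_(i <- s | Q i) f i x @[x --> F] --> \sum_(i <- s | Q i) l i.
Proof.
move=> fl; elim: s => [|i s IH].
  by under eq_fun do rewrite big_nil; rewrite big_nil; exact: cvg_cst.
rewrite big_cons; under eq_fun do rewrite big_cons.
by case: ifP => _ //; exact: cvgD.
Qed.

Lemma cvg_mulmx (T : Type) (F : set_system T) {FF : Filter F} (m n p : nat)
    (f : T -> 'M[R]_(m, n)) (g : T -> 'M[R]_(n, p))
    (A : 'M[R]_(m, n)) (B : 'M[R]_(n, p)) :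
  f x @[x --> F] --> A -> g x @[x --> F] --> B ->
  f x *m g x @[x --> F] --> A *m B.
Proof.
move=> /cvg_mxP fA /cvg_mxP gB; apply/cvg_mxP => i j.
rewrite mxE; under eq_fun do rewrite mxE.
by apply: cvg_bigsum => k; apply: cvgM; [exact: fA|exact: gB].
Qed.

Lemma cvg_trmx (T : Type) (F : set_system T) {FF : Filter F} (m n : nat)
    (f : T -> 'M[R]_(m, n)) (A : 'M[R]_(m, n)) :
  f x @[x --> F] --> A -> (f x)^T @[x --> F] --> A^T.
Proof.
move=> /cvg_mxP fA; apply/cvg_mxP => i j.
by rewrite mxE; under eq_fun do rewrite mxE; exact: fA.
Qed.

Lemma cvg_dot (T : Type) (F : set_system T) {FF : Filter F}
    (f g : T -> vec3 R) (u v : vec3 R) :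
  f x @[x --> F] --> u -> g x @[x --> F] --> v ->
  dot (f x) (g x) @[x --> F] --> dot u v.
Proof.
move=> /cvg_mxP fA /cvg_mxP gB.
by apply: cvg_bigsum => k; apply: cvgM; [exact: fA|exact: gB].
Qed.

Lemma cvg_cross (T : Type) (F : set_system T) {FF : Filter F}
    (f g : T -> vec3 R) (u v : vec3 R) :
  f x @[x --> F] --> u -> g x @[x --> F] --> v ->
  cross (f x) (g x) @[x --> F] --> cross u v.
Proof.
move=> /cvg_mxP fA /cvg_mxP gB; apply/cvg_mxP => i j.
rewrite mxE; under eq_fun do rewrite mxE.
by apply: cvgB; apply: cvgM; [exact: fA|exact: gB|exact: fA|exact: gB].
Qed.

Lemma cvg_vee (T : Type) (F : set_system T) {FF : Filter F}
    (f : T -> mat3 R) (A : mat3 R) :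
  f x @[x --> F] --> A -> vee (f x) @[x --> F] --> vee A.
Proof.
move=> /cvg_mxP fA; apply/cvg_mxP => i j.
by rewrite mxE; under eq_fun do rewrite mxE; exact: fA.
Qed.

Lemma is_derive_mxP (m n : nat) (f : R -> 'M[R]_(m, n)) (t : R) df :
  is_derive t 1 f df <-> forall i j, is_derive t 1 (fun s => f s i j) (df i j).
Proof.
split=> [[fd <-] i j|h].
  have fdij := (derivable_mxP f t 1).1 fd.
  by rewrite derive_mx // mxE; exact/derivableP.
have fd : derivable f t 1.
  by apply/derivable_mxP => i j; have [] := h i j.
apply: DeriveDef => //; rewrite derive_mx //; apply/matrixP => i j.
by rewrite mxE; have [_ ->] := h i j.
Qed.

Lemma is_derive_bigsum (V : normedModType R) (I : Type) (s : seq I)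
    (Q : pred I) (f : I -> R -> V) (t : R) (df : I -> V) :
  (forall i, is_derive t 1 (f i) (df i)) ->
  is_derive t 1 (fun x => \sum_(i <- s | Q i) f i x) (\sum_(i <- s | Q i) df i).
Proof.
move=> fl; elim: s => [|i s IH].
  by under eq_fun do rewrite big_nil; rewrite big_nil; exact: is_derive_cst.
rewrite big_cons; under eq_fun do rewrite big_cons.
by case: ifP => _ //; exact: is_deriveD.
Qed.

Lemma is_derive_mul (f g : R -> R) (t df dg : R) :
  is_derive t 1 f df -> is_derive t 1 g dg ->
  is_derive t 1 (fun x => f x * g x) (df * g t + f t * dg).
Proof.
move=> hf hg; apply: (is_derive_eq (is_deriveM hf hg)).
by rewrite addrC /GRing.scale /= [g t * _]mulrC.
Qed.

Lemma is_derive_mulC (c : R) (f : R -> R) (t df : R) :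
  is_derive t 1 f df -> is_derive t 1 (fun x => c * f x) (c * df).
Proof.
move=> hf; apply: (is_derive_eq (is_derive_mul (is_derive_cst c t 1) hf)).
by rewrite mul0r add0r.
Qed.

Lemma is_derive_chain (h g : R -> R) (x dh dg : R) :
  is_derive (g x) 1 h dh -> is_derive x 1 g dg ->
  is_derive x 1 (fun y => h (g y)) (dh * dg).
Proof.
move=> [hd <-] [gd <-].
have dhg : derivable (h \o g) x 1.
  apply/derivable1_diffP; apply: differentiable_comp.
    exact: (derivable1_diffP _ _).1 gd.
  exact: (derivable1_diffP _ _).1 hd.
apply: (@DeriveDef _ _ _ x 1 (h \o g) _ dhg); rewrite -!derive1E.
exact: (derive1_comp gd hd).
Qed.

Lemma is_derive_mulmx (m n p : nat) (f : R -> 'M[R]_(m, n))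
    (g : R -> 'M[R]_(n, p)) (t : R) df dg :
  is_derive t 1 f df -> is_derive t 1 g dg ->
  is_derive t 1 (fun x => f x *m g x) (df *m g t + f t *m dg).
Proof.
move=> /is_derive_mxP fA /is_derive_mxP gB; apply/is_derive_mxP => i j.
under eq_fun do rewrite mxE; rewrite !mxE -big_split /=.
by apply: is_derive_bigsum => k; exact: is_derive_mul.
Qed.

Lemma is_derive_scale (m n : nat) (f : R -> R) (g : R -> 'M[R]_(m, n))
    (t : R) df dg :
  is_derive t 1 f df -> is_derive t 1 g dg ->
  is_derive t 1 (fun x => f x *: g x) (df *: g t + f t *: dg).
Proof.
move=> fA /is_derive_mxP gB; apply/is_derive_mxP => i j.
under eq_fun do rewrite mxE; rewrite !mxE.
exact: is_derive_mul.
Qed.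

Lemma is_derive_trmx (m n : nat) (f : R -> 'M[R]_(m, n)) (t : R) df :
  is_derive t 1 f df -> is_derive t 1 (fun x => (f x)^T) df^T.
Proof.
move=> /is_derive_mxP fA; apply/is_derive_mxP => i j.
by rewrite mxE; under eq_fun do rewrite mxE; exact: fA.
Qed.

Lemma is_derive_dot (f g : R -> vec3 R) (t : R) df dg :
  is_derive t 1 f df -> is_derive t 1 g dg ->
  is_derive t 1 (fun x => dot (f x) (g x)) (dot df (g t) + dot (f t) dg).
Proof.
move=> /is_derive_mxP fA /is_derive_mxP gB; rewrite /dot -big_split /=.
by apply: is_derive_bigsum => k; exact: is_derive_mul.
Qed.

Lemma is_derive_cross (f g : R -> vec3 R) (t : R) df dg :
  is_derive t 1 f df -> is_derive t 1 g dg ->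
  is_derive t 1 (fun x => cross (f x) (g x)) (cross df (g t) + cross (f t) dg).
Proof.
move=> /is_derive_mxP fA /is_derive_mxP gB; apply/is_derive_mxP => i j.
under eq_fun do rewrite mxE; rewrite !mxE addrACA -opprD.
by apply: is_deriveB; exact: is_derive_mul.
Qed.

Lemma is_derive_vee (f : R -> mat3 R) (t : R) df :
  is_derive t 1 f df -> is_derive t 1 (fun x => vee (f x)) (vee df).
Proof.
move=> /is_derive_mxP fA; apply/is_derive_mxP => i j.
by rewrite mxE; under eq_fun do rewrite mxE; exact: fA.
Qed.

Lemma is_derive1E (V : normedModType R) (f : R -> V) (t : R) df :
  is_derive t 1 f df -> derive1 f t = df.
Proof. by rewrite derive1E => -[_ ->]. Qed.

Lemma derivable_is_derive (V : normedModType R) (f : R -> V) (t : R) :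
  derivable f t 1 -> is_derive t 1 f (derive1 f t).
Proof. by move=> /derivableP; rewrite derive1E. Qed.

Lemma is_derive_continuous (V : normedModType R) (f : R -> V) (t : R) df :
  is_derive t 1 f df -> {for t, continuous f}.
Proof. by case=> /derivable1_diffP/differentiable_continuous. Qed.

Lemma is_derive_unique (V : normedModType R) (f : R -> V) (t : R) df df' :
  is_derive t 1 f df -> is_derive t 1 f df' -> df = df'.
Proof. by move=> [_ <-] [_ <-]. Qed.
Lemma is_derive_ext (V : normedModType R) (f g : R -> V) (A : set R) (t : R)
    df : open A -> A t -> (forall x, A x -> f x = g x) ->
  is_derive t 1 f df -> is_derive t 1 g df.
Proof.
move=> oA At fg; apply: near_eq_is_derive.
have : nbhs t A by exact: open_nbhs_nbhs.
by apply: filterS => x /fg.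
Qed.

End MatrixCalculus.

Section ContinuouslyDifferentiable.
Variable R : realType.

Lemma C1_is_derive (V : normedModType R) (D : set R) (c : R -> V) t :
  C1 D c -> D t -> is_derive t 1 c (derive1 c t).
Proof. by move=> cC1 /cC1[h _]; exact: derivable_is_derive. Qed.

Lemma C1_continuous (V : normedModType R) (D : set R) (c : R -> V) t :
  C1 D c -> D t -> {for t, continuous c}.
Proof. by move=> cC1 Dt; exact: is_derive_continuous (C1_is_derive cC1 Dt). Qed.

Lemma C1I (V : normedModType R) (D : set R) (c c' : R -> V) : open D ->
  (forall t, D t -> is_derive t 1 c (c' t)) ->
  (forall t, D t -> {for t, continuous c'}) -> C1 D c.
Proof.
move=> oD cc' cont t Dt; split; first by have [] := cc' t Dt.
rewrite /prop_for /continuous_at (is_derive1E (cc' t Dt)).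
apply: cvg_trans (cont t Dt); apply: near_eq_cvg.
have : nbhs t D by exact: open_nbhs_nbhs.
by apply: filterS => x Dx; rewrite (is_derive1E (cc' x Dx)).
Qed.

Lemma C2I (V : normedModType R) (D : set R) (c c' c'' : R -> V) : open D ->
  (forall t, D t -> is_derive t 1 c (c' t)) ->
  (forall t, D t -> is_derive t 1 c' (c'' t)) ->
  (forall t, D t -> {for t, continuous c''}) -> C2 D c.
Proof.
move=> oD cc' cc'' cont; split.
  by apply: (C1I oD cc') => t Dt; exact: is_derive_continuous (cc'' t Dt).
apply: (C1I oD (c' := c'')) => // t Dt.
apply: (is_derive_ext oD Dt _ (cc'' t Dt)) => x Dx.
by rewrite (is_derive1E (cc' x Dx)).
Qed.

Lemma C1_ext (V : normedModType R) (D : set R) (c d : R -> V) : open D ->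
  (forall t, D t -> c t = d t) -> C1 D c -> C1 D d.
Proof.
move=> oD cd cC1; apply: (C1I oD (c' := derive1 c)) => t Dt.
  exact: (is_derive_ext oD Dt cd (C1_is_derive cC1 Dt)).
by have [] := cC1 _ Dt.
Qed.

Lemma C1_cst (V : normedModType R) (D : set R) (v : V) :
  open D -> C1 D (fun=> v).
Proof.
move=> oD; apply: (C1I oD (c' := fun=> 0)) => t _.
exact: cvg_cst.
Qed.

Lemma C2_cst (V : normedModType R) (D : set R) (v : V) : open D ->
  C2 D (fun=> v).
Proof.
move=> oD; apply: (@C2I V D (fun=> v) (fun=> 0) (fun=> 0) oD) => t _.
exact: cvg_cst.
Qed.

Lemma C2_subset (V : normedModType R) (D D' : set R) (c : R -> V) :
  D `<=` D' -> C2 D' c -> C2 D c.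
Proof. by move=> DD' [c1 c2]; split=> t /DD'; [exact: c1|exact: c2]. Qed.

Lemma C2_mulmxr (D : set R) (A : R -> mat3 R) (B : mat3 R) : open D ->
  C2 D A -> C2 D (fun t => A t *m B).
Proof.
move=> oD [AC1 A'C1].
apply: (@C2I _ D (fun t => A t *m B) (fun t => derive1 A t *m B)
  (fun t => derive1 (derive1 A) t *m B) oD) => t Dt.
- apply: (is_derive_eq (is_derive_mulmx (C1_is_derive AC1 Dt)
    (is_derive_cst B t 1))).
  by rewrite mulmx0 addr0.
- apply: (is_derive_eq (is_derive_mulmx (C1_is_derive A'C1 Dt)
    (is_derive_cst B t 1))).
  by rewrite mulmx0 addr0.
- have [_ cA] := A'C1 _ Dt.
  by apply: cvg_mulmx; [exact: cA|exact: cvg_cst].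
Qed.

Lemma C2_mulmxl (D : set R) (A : mat3 R) (q : R -> vec3 R) : open D ->
  C2 D q -> C2 D (fun t => A *m q t).
Proof.
move=> oD [qC1 q'C1].
apply: (@C2I _ D (fun t => A *m q t) (fun t => A *m derive1 q t)
  (fun t => A *m derive1 (derive1 q) t) oD) => t Dt.
- apply: (is_derive_eq (is_derive_mulmx (is_derive_cst A t 1)
    (C1_is_derive qC1 Dt))).
  by rewrite mul0mx add0r.
- apply: (is_derive_eq (is_derive_mulmx (is_derive_cst A t 1)
    (C1_is_derive q'C1 Dt))).
  by rewrite mul0mx add0r.
- have [_ cq] := q'C1 _ Dt.
  by apply: cvg_mulmx; [exact: cvg_cst|exact: cq].
Qed.
End ContinuouslyDifferentiable.

(** * Functions of two variables *)

Section JointCalculus.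
Variable R : realType.

(** The mean value theorem without an order between the end points, so that
    increments of both signs are treated alike. *)
Lemma mvt_centered (f df : R -> R) (a b : R) :
  (forall x, `|x - a| <= `|b - a| -> is_derive x 1 f (df x)) ->
  exists2 c, `|c - a| <= `|b - a| & f b - f a = df c * (b - a).
Proof.
move=> fdf; have [ab|ba] := leP a b.
  have le_x x : x \in `[a, b] -> `|x - a| <= `|b - a|.
    rewrite in_itv /= => /andP[ax xb].
    by rewrite !ger0_norm ?subr_ge0 // lerD2r.
  have [||c cab e] := @MVT_segment R f df a b ab.
  - by move=> x /subset_itv_oo_cc /le_x /fdf.
  - by apply: derivable_within_continuous => x /le_x/fdf[].
  by exists c => //; exact: le_x.
have le_x x : x \in `[b, a] -> `|x - a| <= `|b - a|.
  rewrite in_itv /= => /andP[bx xa].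
  by rewrite !ler0_norm ?subr_le0 // ?(ltW ba) // !opprB lerD2l lerN2.
have [||c cab e] := @MVT_segment R f df b a (ltW ba).
- by move=> x /subset_itv_oo_cc /le_x /fdf.
- by apply: derivable_within_continuous => x /le_x/fdf[].
by exists c; [exact: le_x | rewrite -[LHS]opprB e -mulrN opprB].
Qed.

Lemma nbhs_square (e t : R) (Q : R * R -> Prop) :
  nbhs (e, t) Q <-> exists2 d : R, 0 < d &
    forall x y, `|x - e| < d -> `|y - t| < d -> Q (x, y).
Proof.
split=> [/nbhs_ballP[d /= d0 dQ]|[d d0 dQ]].
  by exists d => // x y xe yt; apply: dQ; split; rewrite /= /ball /= distrC.
apply/nbhs_ballP; exists d => //= -[x y] [/= xe yt].
by apply: dQ; rewrite distrC.
Qed.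

Lemma nbhs_open_square (E D : set R) (e t : R) (Q : R * R -> Prop) :
  open E -> open D -> E e -> D t ->
  (forall x y, E x -> D y -> Q (x, y)) -> nbhs (e, t) Q.
Proof.
move=> oE oD Ee Dt h.
exists (E, D); first by split; [exact: open_nbhs_nbhs|exact: open_nbhs_nbhs].
by move=> [x y] [/= Ex Dy]; exact: h.
Qed.

Lemma jcont_ext (V : normedModType R) (E D : set R) (u v : R -> R -> V)
    (e t : R) : open E -> open D -> E e -> D t ->
  (forall x y, E x -> D y -> u x y = v x y) ->
  {for (e, t), continuous (fun p : R * R => u p.1 p.2)} ->
  {for (e, t), continuous (fun p : R * R => v p.1 p.2)}.
Proof.
move=> oE oD Ee Dt uv; rewrite /prop_for /continuous_at /= -uv // => cu.
apply: cvg_trans cu; apply: near_eq_cvg.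
by apply: nbhs_open_square oE oD Ee Dt _ => x y Ex Dy /=; rewrite uv.
Qed.

Section OnOpen.
Variables (E D : set R).
Hypotheses (oE : open E) (oD : open D).

Lemma jointC1_eps (V : normedModType R) (u : R -> R -> V) e t :
  jointC1 E D u -> E e -> D t -> is_derive e 1 (u ^~ t) (d_eps u e t).
Proof.
by move=> uC1 Ee Dt; have [h _ _ _] := uC1 _ _ Ee Dt; exact: derivable_is_derive.
Qed.

Lemma jointC1_time (V : normedModType R) (u : R -> R -> V) e t :
  jointC1 E D u -> E e -> D t -> is_derive t 1 (u e) (d_time u e t).
Proof.
by move=> uC1 Ee Dt; have [_ h _ _] := uC1 _ _ Ee Dt; exact: derivable_is_derive.
Qed.

(** The candidates ue and ut are partial derivatives of u on E x D only.  As E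
    and D are open, that determines d_eps u and d_time u in a neighbourhood of
    each point of E x D. *)
Lemma jointC1I (V : normedModType R) (u ue ut : R -> R -> V) :
  (forall e t, E e -> D t -> is_derive e 1 (u ^~ t) (ue e t)) ->
  (forall e t, E e -> D t -> is_derive t 1 (u e) (ut e t)) ->
  (forall e t, E e -> D t ->
    {for (e, t), continuous (fun p : R * R => ue p.1 p.2)}) ->
  (forall e t, E e -> D t ->
    {for (e, t), continuous (fun p : R * R => ut p.1 p.2)}) ->
  jointC1 E D u.
Proof.
move=> hue hut cue cut e t Ee Dt; split.
- by have [] := hue _ _ Ee Dt.
- by have [] := hut _ _ Ee Dt.
- apply: jcont_ext oE oD Ee Dt _ (cue _ _ Ee Dt) => x y Ex Dy.
  by rewrite /d_eps (is_derive1E (hue _ _ Ex Dy)).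
- apply: jcont_ext oE oD Ee Dt _ (cut _ _ Ee Dt) => x y Ex Dy.
  by rewrite /d_time (is_derive1E (hut _ _ Ex Dy)).
Qed.

Lemma jointC1_ext (V : normedModType R) (u v : R -> R -> V) :
  (forall e t, E e -> D t -> u e t = v e t) ->
  jointC1 E D u -> jointC1 E D v.
Proof.
move=> uv uC1; apply: (@jointC1I _ _ (d_eps u) (d_time u)) => e t Ee Dt.
- apply: (is_derive_ext oE Ee _ (jointC1_eps uC1 Ee Dt)) => x Ex.
  exact: uv.
- apply: (is_derive_ext oD Dt _ (jointC1_time uC1 Ee Dt)) => x Dx.
  exact: uv.
- by have [] := uC1 _ _ Ee Dt.
- by have [] := uC1 _ _ Ee Dt.
Qed.

Lemma jointC1_coord (m n : nat) (u : R -> R -> 'M[R]_(m, n)) i j :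
  jointC1 E D u -> jointC1 E D (fun e t => u e t i j).
Proof.
move=> uC1.
apply: (@jointC1I _ _ (fun e t => d_eps u e t i j)
  (fun e t => d_time u e t i j)) => e t Ee Dt.
- by have /is_derive_mxP := jointC1_eps uC1 Ee Dt.
- by have /is_derive_mxP := jointC1_time uC1 Ee Dt.
- by have [_ _ /cvg_mxP h _] := uC1 _ _ Ee Dt; exact: h.
- by have [_ _ _ /cvg_mxP h] := uC1 _ _ Ee Dt; exact: h.
Qed.

(** Near (e, t) the partial derivative d_eps u is bounded, so u is Lipschitz
    in its first variable, uniformly in the second; along the line of parameter
    e it is continuous because it is derivable in time. *)
Lemma jointC1_continuous_scalar (u : R -> R -> R) e t :
  jointC1 E D u -> E e -> D t ->
  {for (e, t), continuous (fun p : R * R => u p.1 p.2)}.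
Proof.
move=> uC1 Ee Dt; have [_ dt ce _] := uC1 _ _ Ee Dt.
pose K := `|d_eps u e t| + 1.
have K0 : 0 < K by rewrite ltr_wpDl.
have [d d0 bd] : exists2 d : R, 0 < d & forall x y, `|x - e| < d ->
    `|y - t| < d -> [/\ E x, D y & `|d_eps u x y| <= K].
  apply/(nbhs_square e t (fun p => [/\ E p.1, D p.2 & `|d_eps u p.1 p.2| <= K])).
  near=> p; split.
  - by near: p; apply: nbhs_open_square oE oD Ee Dt _.
  - by near: p; apply: nbhs_open_square oE oD Ee Dt _.
  near: p; apply: (@cvgr_norm_le _ _ _ _ _ _ _ ce).
  by rewrite /K ltrDl.
have ct : {for t, continuous (u e)}.
  exact: is_derive_continuous (jointC1_time uC1 Ee Dt).
apply/cvgrPdist_le => /= r r0.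
have r20 : 0 < r / 2 by rewrite divr_gt0.
have [d' /= d'0 bd'] := (cvgrPdist_le _ _).1 ct _ r20.
apply/(nbhs_square e t (fun p => `|u e t - u p.1 p.2| <= r)).
exists (Num.min (Num.min d d') (r / (2 * K))).
  by rewrite !lt_min d0 d'0 /= divr_gt0 // mulr_gt0.
move=> x y /=; rewrite !lt_min => /andP[/andP[xd xd'] xr] /andP[/andP[yd yd'] _].
have [c cx e1] : exists2 c, `|c - e| <= `|x - e| &
    u x y - u e y = d_eps u c y * (x - e).
  apply: (@mvt_centered (u ^~ y) (d_eps u ^~ y)) => z zx.
  have [Ez Dy _] := bd z y (le_lt_trans zx xd) yd.
  exact: jointC1_eps uC1 Ez Dy.
have [_ _ leK] := bd c y (le_lt_trans cx xd) yd.
rewrite -(subrKA (u e y)) (le_trans (ler_normD _ _)) // [leRHS]splitr lerD //.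
  by apply: bd' => /=; rewrite distrC.
rewrite distrC e1 normrM (le_trans (ler_pM _ _ leK (ltW xr))) //.
rewrite (_ : K * (r / (2 * K)) = r / 2) //.
by field; rewrite gt_eqF.
Unshelve. all: by end_near. Qed.

Lemma jointC1_continuous (m n : nat) (u : R -> R -> 'M[R]_(m, n)) e t :
  jointC1 E D u -> E e -> D t ->
  {for (e, t), continuous (fun p : R * R => u p.1 p.2)}.
Proof.
move=> uC1 Ee Dt; apply/cvg_mxP => i j.
exact: (jointC1_continuous_scalar (jointC1_coord i j uC1) Ee Dt).
Qed.

(** The mean value theorem in the second variable, for the difference of two
    columns, then in the first. *)
Lemma double_mvt (u ut utx : R -> R -> R) (e t h : R) :
  0 < h ->
  (forall x y, `|x - e| <= h -> `|y - t| <= h -> is_derive y 1 (u x) (ut x y)) ->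
  (forall x y, `|x - e| <= h -> `|y - t| <= h ->
    is_derive x 1 (ut ^~ y) (utx x y)) ->
  exists x y, [/\ `|x - e| <= h, `|y - t| <= h &
    u (e + h) (t + h) - u e (t + h) - u (e + h) t + u e t = utx x y * h * h].
Proof.
move=> h0 hut hutx.
have hh : `|h| = h by rewrite gtr0_norm.
have e_h : `|e + h - e| = h by rewrite addrAC subrr add0r.
have t_h : `|t + h - t| = h by rewrite addrAC subrr add0r.
have e_e : `|e - e| <= h by rewrite subrr normr0 ltW.
have [y yh e1] : exists2 y, `|y - t| <= `|t + h - t| &
    (u (e + h) (t + h) - u e (t + h)) - (u (e + h) t - u e t) =
    (ut (e + h) y - ut e y) * (t + h - t).
  apply: (@mvt_centered (fun y => u (e + h) y - u e y)
    (fun y => ut (e + h) y - ut e y)) => y yt.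
  by apply: is_deriveB; apply: hut; rewrite ?e_h // -t_h.
rewrite t_h in yh.
have [x xh e2] : exists2 x, `|x - e| <= `|e + h - e| &
    ut (e + h) y - ut e y = utx x y * (e + h - e).
  apply: (@mvt_centered (ut ^~ y) (utx ^~ y)) => x xe.
  by apply: hutx; rewrite // -e_h.
rewrite e_h in xh.
exists x, y; split => //.
rewrite e2 in e1.
transitivity (u (e + h) (t + h) - u e (t + h) - (u (e + h) t - u e t)).
  by ring.
by rewrite e1; ring.
Qed.

(** By [double_mvt], each mixed derivative, at some point of a small square,
    computes the same second difference of u.  The square shrinks to (e, t), so
    by continuity the two values agree there. *)
Lemma schwarz_scalar (u ue ut uet ute : R -> R -> R) e t :
  (forall x y, E x -> D y -> is_derive x 1 (u ^~ y) (ue x y)) ->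
  (forall x y, E x -> D y -> is_derive y 1 (u x) (ut x y)) ->
  (forall x y, E x -> D y -> is_derive y 1 (ue x) (uet x y)) ->
  (forall x y, E x -> D y -> is_derive x 1 (ut ^~ y) (ute x y)) ->
  E e -> D t ->
  {for (e, t), continuous (fun p : R * R => uet p.1 p.2)} ->
  {for (e, t), continuous (fun p : R * R => ute p.1 p.2)} ->
  ute e t = uet e t.
Proof.
move=> hue hut huet hute Ee Dt ca cb.
apply/eqP; rewrite -subr_eq0 -normr_le0; apply/ler_addgt0Pr => r r0.
rewrite add0r.
have r20 : 0 < r / 2 by rewrite divr_gt0.
move/cvgrPdist_le: ca => /(_ _ r20) /= ca.
move/cvgrPdist_le: cb => /(_ _ r20) /= cb.
have [d d0 bd] : exists2 d : R, 0 < d & forall x y, `|x - e| < d ->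
    `|y - t| < d -> [/\ E x, D y,
      `|ute e t - ute x y| <= r / 2 &
      `|uet e t - uet x y| <= r / 2].
  apply/(nbhs_square e t (fun p => [/\ E p.1, D p.2,
      `|ute e t - ute p.1 p.2| <= r / 2 &
      `|uet e t - uet p.1 p.2| <= r / 2])).
  have ED : nbhs (e, t) (fun p : R * R => E p.1 /\ D p.2).
    exact: nbhs_open_square oE oD Ee Dt _.
  apply: filterS (filterI ED (filterI cb ca)) => p [[Ex Dy] [h1 h2]].
  by split; [exact: Ex|exact: Dy|exact: h1|exact: h2].
pose h := d / 2; have h0 : 0 < h by rewrite divr_gt0.
have hd x : x <= h -> x < d.
  by move=> /le_lt_trans; apply; rewrite /h ltr_pdivrMr // ltr_pMr // ltr1n.
have [||x [y [xe yt e1]]] :=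
  @double_mvt u ut ute e t h h0.
- move=> x y /hd xe /hd yt; have [Ex Dy _ _] := bd _ _ xe yt.
  exact: hut.
- move=> x y /hd xe /hd yt; have [Ex Dy _ _] := bd _ _ xe yt.
  exact: hute.
have [||y' [x' [yt' xe' e2]]] := @double_mvt (fun y x => u x y)
  (fun y x => ue x y) (fun y x => uet x y) t e h h0.
- move=> y' x' /hd yt' /hd xe'; have [Ex Dy _ _] := bd _ _ xe' yt'.
  exact: hue.
- move=> y' x' /hd yt' /hd xe'; have [Ex Dy _ _] := bd _ _ xe' yt'.
  exact: huet.
have ee : ute x y = uet x' y'.
  apply: (mulIf (lt0r_neq0 h0)); apply: (mulIf (lt0r_neq0 h0)).
  by rewrite -e1 -e2; ring.
have [_ _ b1 _] := bd _ _ (hd _ xe) (hd _ yt).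
have [_ _ _ b2] := bd _ _ (hd _ xe') (hd _ yt').
rewrite -(subrKA (ute x y)) (le_trans (ler_normD _ _)) //.
by rewrite [leRHS]splitr lerD // ee distrC.
Qed.

Lemma schwarz (m n : nat) (u : R -> R -> 'M[R]_(m, n)) e t :
  jointC2 E D u -> E e -> D t -> d_eps (d_time u) e t = d_time (d_eps u) e t.
Proof.
move=> [uC1 ueC1 utC1] Ee Dt; apply/matrixP => i j.
apply: (@schwarz_scalar (fun e t => u e t i j) (fun e t => d_eps u e t i j)
  (fun e t => d_time u e t i j) (fun e t => d_time (d_eps u) e t i j)
  (fun e t => d_eps (d_time u) e t i j) e t)
  => // [x y Ex Dy|x y Ex Dy|x y Ex Dy|x y Ex Dy||].
- by have /is_derive_mxP := jointC1_eps uC1 Ex Dy.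
- by have /is_derive_mxP := jointC1_time uC1 Ex Dy.
- by have /is_derive_mxP := jointC1_time ueC1 Ex Dy.
- by have /is_derive_mxP := jointC1_eps utC1 Ex Dy.
- by have [_ _ _ /cvg_mxP h] := ueC1 _ _ Ee Dt; exact: h.
- by have [_ _ /cvg_mxP h _] := utC1 _ _ Ee Dt; exact: h.
Qed.

End OnOpen.
End JointCalculus.

Section JointClosure.
Variables (R : realType) (E D : set R).
Hypotheses (oE : open E) (oD : open D).

(** The families of motions used as test variations are built from curves, the
    scalars e phi(t), sines and cosines, sums and products.  The closure
    properties below give their regularity. *)
Lemma jointC1_static (V : normedModType R) (c : R -> V) :
  C1 D c -> jointC1 E D (fun=> c).
Proof.
move=> cC1; apply: (jointC1I oE oD (ue := fun _ _ => 0)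
  (ut := fun _ t => derive1 c t)) => e t Ee Dt.
- exact: is_derive_cst.
- exact: C1_is_derive cC1 Dt.
- exact: cvg_cst.
- have [_ ct] := cC1 _ Dt.
  exact: (cvg_comp _ _ (@cvg_snd _ _ (nbhs e) (nbhs t) _) ct).
Qed.

Lemma jointC2_static (V : normedModType R) (c : R -> V) :
  C2 D c -> jointC2 E D (fun=> c).
Proof.
move=> [cC1 dcC1]; split; [exact: jointC1_static| |exact: jointC1_static].
rewrite (_ : d_eps _ = fun=> (fun=> 0)); first exact/jointC1_static/(C1_cst _ oD).
apply/funext => e; apply/funext => t; exact: (is_derive1E (is_derive_cst (c t) e 1)).
Qed.

Lemma cvg_joint_fst (e t : R) : p.1 @[p --> (e, t)] --> e.
Proof. exact: (@cvg_fst _ _ (nbhs e) (nbhs t) _). Qed.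

Lemma cvg_joint_snd (V : normedModType R) (c : R -> V) (e t : R) :
  {for t, continuous c} -> c p.2 @[p --> (e, t)] --> c t.
Proof.
by move=> ct; exact: (cvg_comp _ _ (@cvg_snd _ _ (nbhs e) (nbhs t) _) ct).
Qed.

Lemma jointC1_linear (phi : R -> R) : C1 D phi ->
  jointC1 E D (fun e t => e * phi t).
Proof.
move=> phiC1; apply: (jointC1I oE oD (ue := fun _ t => phi t)
  (ut := fun e t => e * derive1 phi t)) => e t Ee Dt.
- apply: (is_derive_eq (is_derive_mul (is_derive_id e 1)
    (is_derive_cst (phi t) e 1))).
  by rewrite mulr0 addr0 mul1r.
- apply: (is_derive_eq (is_derive_mul (is_derive_cst e t 1)
    (C1_is_derive phiC1 Dt))).
  by rewrite mul0r add0r.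
- exact: cvg_joint_snd (C1_continuous phiC1 Dt).
- have [_ ct] := phiC1 _ Dt.
  by apply: cvgM; [exact: cvg_joint_fst|exact: cvg_joint_snd].
Qed.

Lemma jointC2_linear (phi : R -> R) : C2 D phi ->
  jointC2 E D (fun e t => e * phi t).
Proof.
move=> [phiC1 dphiC1]; split; first exact: jointC1_linear.
- apply: (jointC1_ext oE oD _ (jointC1_static phiC1)) => e t Ee Dt.
  apply/esym/is_derive1E; apply: (is_derive_eq (is_derive_mul
    (is_derive_id e 1) (is_derive_cst (phi t) e 1))).
  by rewrite mulr0 addr0 mul1r.
- apply: (jointC1_ext oE oD _ (jointC1_linear dphiC1)) => e t Ee Dt.
  apply/esym/is_derive1E; apply: (is_derive_eq (is_derive_mul
    (is_derive_cst e t 1) (C1_is_derive phiC1 Dt))).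
  by rewrite mul0r add0r.
Qed.

Section Matrices.
Variables m n : nat.
Implicit Types u v : R -> R -> 'M[R]_(m, n).

Lemma jointC1D u v : jointC1 E D u -> jointC1 E D v ->
  jointC1 E D (fun e t => u e t + v e t).
Proof.
move=> uC1 vC1; apply: (jointC1I oE oD
  (ue := fun e t => d_eps u e t + d_eps v e t)
  (ut := fun e t => d_time u e t + d_time v e t)) => e t Ee Dt.
- by apply: is_deriveD;
    [exact: (jointC1_eps uC1 Ee Dt)|exact: (jointC1_eps vC1 Ee Dt)].
- by apply: is_deriveD;
    [exact: (jointC1_time uC1 Ee Dt)|exact: (jointC1_time vC1 Ee Dt)].
- have [_ _ cu _] := uC1 _ _ Ee Dt; have [_ _ cv _] := vC1 _ _ Ee Dt.
  exact: (cvgD cu cv).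
- have [_ _ _ cu] := uC1 _ _ Ee Dt; have [_ _ _ cv] := vC1 _ _ Ee Dt.
  exact: (cvgD cu cv).
Qed.

Lemma jointC2D u v : jointC2 E D u -> jointC2 E D v ->
  jointC2 E D (fun e t => u e t + v e t).
Proof.
move=> [uC1 ueC1 utC1] [vC1 veC1 vtC1]; split; first exact: jointC1D.
- apply: (jointC1_ext oE oD _ (jointC1D ueC1 veC1)) => e t Ee Dt.
  by apply/esym/is_derive1E/is_deriveD;
    [exact: (jointC1_eps uC1 Ee Dt)|exact: (jointC1_eps vC1 Ee Dt)].
- apply: (jointC1_ext oE oD _ (jointC1D utC1 vtC1)) => e t Ee Dt.
  by apply/esym/is_derive1E/is_deriveD;
    [exact: (jointC1_time uC1 Ee Dt)|exact: (jointC1_time vC1 Ee Dt)].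
Qed.

Lemma jointC1Z (a : R -> R -> R) u : jointC1 E D a -> jointC1 E D u ->
  jointC1 E D (fun e t => a e t *: u e t).
Proof.
move=> aC1 uC1; apply: (jointC1I oE oD
  (ue := fun e t => d_eps a e t *: u e t + a e t *: d_eps u e t)
  (ut := fun e t => d_time a e t *: u e t + a e t *: d_time u e t))
  => e t Ee Dt.
- apply: (@is_derive_scale _ _ _ (a ^~ t) (u ^~ t));
    [exact: (jointC1_eps aC1 Ee Dt)|exact: (jointC1_eps uC1 Ee Dt)].
- apply: (@is_derive_scale _ _ _ (a e) (u e));
    [exact: (jointC1_time aC1 Ee Dt)|exact: (jointC1_time uC1 Ee Dt)].
- have [_ _ ca' _] := aC1 _ _ Ee Dt; have [_ _ cu' _] := uC1 _ _ Ee Dt.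
  have ca := jointC1_continuous_scalar oE oD aC1 Ee Dt.
  have cu := jointC1_continuous oE oD uC1 Ee Dt.
  exact: (cvgD (cvgZ ca' cu) (cvgZ ca cu')).
- have [_ _ _ ca'] := aC1 _ _ Ee Dt; have [_ _ _ cu'] := uC1 _ _ Ee Dt.
  have ca := jointC1_continuous_scalar oE oD aC1 Ee Dt.
  have cu := jointC1_continuous oE oD uC1 Ee Dt.
  exact: (cvgD (cvgZ ca' cu) (cvgZ ca cu')).
Qed.

Lemma jointC2Z (a : R -> R -> R) u : jointC2 E D a -> jointC2 E D u ->
  jointC2 E D (fun e t => a e t *: u e t).
Proof.
move=> [aC1 aeC1 atC1] [uC1 ueC1 utC1]; split; first exact: jointC1Z.
- apply: (jointC1_ext oE oD _
    (jointC1D (jointC1Z aeC1 uC1) (jointC1Z aC1 ueC1))) => e t Ee Dt.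
  apply/esym/is_derive1E; apply: (@is_derive_scale _ _ _ (a ^~ t) (u ^~ t));
    [exact: (jointC1_eps aC1 Ee Dt)|exact: (jointC1_eps uC1 Ee Dt)].
- apply: (jointC1_ext oE oD _
    (jointC1D (jointC1Z atC1 uC1) (jointC1Z aC1 utC1))) => e t Ee Dt.
  apply/esym/is_derive1E; apply: (@is_derive_scale _ _ _ (a e) (u e));
    [exact: (jointC1_time aC1 Ee Dt)|exact: (jointC1_time uC1 Ee Dt)].
Qed.
End Matrices.

Lemma jointC1_mul (a b : R -> R -> R) : jointC1 E D a -> jointC1 E D b ->
  jointC1 E D (fun e t => a e t * b e t).
Proof.
move=> aC1 uC1; apply: (jointC1I oE oD (u := fun e t => a e t * b e t)
  (ue := fun e t => d_eps a e t * b e t + a e t * d_eps b e t)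
  (ut := fun e t => d_time a e t * b e t + a e t * d_time b e t))
  => e t Ee Dt.
- apply: (@is_derive_mul _ (a ^~ t) (b ^~ t));
    [exact: (jointC1_eps aC1 Ee Dt)|exact: (jointC1_eps uC1 Ee Dt)].
- apply: (@is_derive_mul _ (a e) (b e));
    [exact: (jointC1_time aC1 Ee Dt)|exact: (jointC1_time uC1 Ee Dt)].
- have [_ _ ca' _] := aC1 _ _ Ee Dt; have [_ _ cu' _] := uC1 _ _ Ee Dt.
  have ca := jointC1_continuous_scalar oE oD aC1 Ee Dt.
  have cu := jointC1_continuous_scalar oE oD uC1 Ee Dt.
  exact: (cvgD (cvgM ca' cu) (cvgM ca cu')).
- have [_ _ _ ca'] := aC1 _ _ Ee Dt; have [_ _ _ cu'] := uC1 _ _ Ee Dt.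
  have ca := jointC1_continuous_scalar oE oD aC1 Ee Dt.
  have cu := jointC1_continuous_scalar oE oD uC1 Ee Dt.
  exact: (cvgD (cvgM ca' cu) (cvgM ca cu')).
Qed.

Lemma jointC1_comp (h : R -> R) (u : R -> R -> R) :
  C1 setT h -> jointC1 E D u -> jointC1 E D (fun e t => h (u e t)).
Proof.
move=> hC1 uC1; apply: (jointC1I oE oD
  (ue := fun e t => derive1 h (u e t) * d_eps u e t)
  (ut := fun e t => derive1 h (u e t) * d_time u e t)) => e t Ee Dt.
- exact: (@is_derive_chain _ h (u ^~ t) _ _ _ (C1_is_derive hC1 I)
    (jointC1_eps uC1 Ee Dt)).
- exact: (@is_derive_chain _ h (u e) _ _ _ (C1_is_derive hC1 I)
    (jointC1_time uC1 Ee Dt)).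
- have [_ _ cu' _] := uC1 _ _ Ee Dt; have [//|_ ch] := hC1 (u e t).
  have cu := jointC1_continuous_scalar oE oD uC1 Ee Dt.
  have chu : derive1 h (u p.1 p.2) @[p --> (e, t)] --> derive1 h (u e t).
    exact: (@cvg_comp _ _ _ (fun p : R * R => u p.1 p.2) (derive1 h) _ _ _ cu ch).
  exact: (cvgM chu cu').
- have [_ _ _ cu'] := uC1 _ _ Ee Dt; have [//|_ ch] := hC1 (u e t).
  have cu := jointC1_continuous_scalar oE oD uC1 Ee Dt.
  have chu : derive1 h (u p.1 p.2) @[p --> (e, t)] --> derive1 h (u e t).
    exact: (@cvg_comp _ _ _ (fun p : R * R => u p.1 p.2) (derive1 h) _ _ _ cu ch).
  exact: (cvgM chu cu').
Qed.

Lemma jointC2_comp (h : R -> R) (u : R -> R -> R) :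
  C2 setT h -> jointC2 E D u -> jointC2 E D (fun e t => h (u e t)).
Proof.
move=> [hC1 h'C1] [uC1 ueC1 utC1]; split; first exact: jointC1_comp.
- apply: (jointC1_ext oE oD _ (jointC1_mul (jointC1_comp h'C1 uC1) ueC1)).
  move=> e t Ee Dt; apply/esym/is_derive1E.
  exact: (@is_derive_chain _ h (u ^~ t) _ _ _ (C1_is_derive hC1 I)
    (jointC1_eps uC1 Ee Dt)).
- apply: (jointC1_ext oE oD _ (jointC1_mul (jointC1_comp h'C1 uC1) utC1)).
  move=> e t Ee Dt; apply/esym/is_derive1E.
  exact: (@is_derive_chain _ h (u e) _ _ _ (C1_is_derive hC1 I)
    (jointC1_time uC1 Ee Dt)).
Qed.
End JointClosure.

(** * Integrals over a segment *)

Section Integrals.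
Variable R : realType.
Local Notation mu := (@lebesgue_measure R).

Section Segment.
Variables a b : R.
Hypothesis ab : a < b.

Lemma continuous_at_within (V : normedModType R) (f : R -> V) :
  (forall t, t \in `[a, b] -> {for t, continuous f}) ->
  {within `[a, b], continuous f}.
Proof.
by move=> cf; apply: continuous_in_subspaceT => t; rewrite inE => /cf.
Qed.

Lemma continuous_integrable (f : R -> R) :
  (forall t, t \in `[a, b] -> {for t, continuous f}) ->
  mu.-integrable `[a, b] (EFin \o f).
Proof.
move=> cf; apply: continuous_compact_integrable; first exact: segment_compact.
exact: continuous_at_within.
Qed.

Lemma Rintegral_derive (G g : R -> R) :
  (forall t, t \in `[a, b] -> is_derive t 1 G (g t)) ->
  (forall t, t \in `[a, b] -> {for t, continuous g}) ->
  \int[mu]_(t in `[a, b]) g t = G b - G a.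
Proof.
move=> Gg cg.
rewrite /Rintegral (@continuous_FTC2 R g G a b ab) //.
- exact: continuous_at_within.
- split.
  + move=> t tab; have [|//] := Gg t _.
    exact: subset_itv_oo_cc.
  + apply: cvg_at_right_filter.
    by apply: is_derive_continuous (Gg a _); rewrite in_itv /= lexx ltW.
  + apply: cvg_at_left_filter.
    by apply: is_derive_continuous (Gg b _); rewrite in_itv /= lexx ltW.
- move=> t tab; apply: is_derive1E; apply: Gg.
  exact: subset_itv_oo_cc.
Qed.

(** Differentiation under the integral sign needs an integrable bound on F';
    continuity on the compact rectangle [-r/2, r/2] x [a, b] gives a constant
    one. *)
Lemma is_derive_Rintegral (r : R) (F F' : R -> R -> R) : 0 < r ->
  (forall e t : R, `|e| < r -> t \in `[a, b] -> is_derive e 1 (F ^~ t) (F' e t)) ->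
  (forall e t : R, `|e| < r -> t \in `[a, b] ->
    {for (e, t), continuous (fun p : R * R => F' p.1 p.2)}) ->
  (forall e t : R, `|e| < r -> t \in `[a, b] -> {for t, continuous (F e)}) ->
  is_derive (0 : R) 1 (fun e => \int[mu]_(t in `[a, b]) F e t)
    (\int[mu]_(t in `[a, b]) F' 0 t).
Proof.
move=> r0 dF cF' cF.
pose d := r / 2; have d0 : 0 < d by rewrite divr_gt0.
have dr (e : R) : `|e| <= d -> `|e| < r.
  by move=> /le_lt_trans; apply; rewrite /d ltr_pdivrMr // ltr_pMr // ltr1n.
have Ir (e : R) : `](- d), d[%classic e -> `|e| < r.
  by rewrite /= in_itv /= -ltr_norml => /ltW /dr.
have I0 : `](- d), d[%classic (0 : R) by rewrite /= in_itv /= oppr_lt0 d0.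
have [K K0 KF'] : exists2 K : R, 0 <= K & forall e t, `|e| <= d ->
    t \in `[a, b] -> `|F' e t| <= K.
  pose f (p : R * R) := F' p.1 p.2.
  have cpt : compact (`[- d, d]%classic `*` `[a, b]%classic).
    by apply: compact_setX; exact: segment_compact.
  have cf : {within `[- d, d]%classic `*` `[a, b]%classic, continuous f}.
    apply: continuous_in_subspaceT => -[e t]; rewrite inE => -[/= ed tab].
    by apply: cF' => //; apply: dr; rewrite ler_norml; move: ed; rewrite in_itv.
  have [M [_ Mf]] := compact_bounded (continuous_compact cf cpt).
  exists `|M + 1|; first exact: normr_ge0.
  move=> e t ed tab; rewrite (le_trans _ (ler_norm _)) //.
  apply: (Mf (M + 1)); first by rewrite ltrDl.
  by exists (e, t) => //; split => //=; rewrite in_itv /= -ler_norml.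
have mI : measurable (`[a, b]%classic : set (measurableTypeR R)) by [].
have derf1 (x y : R) : `](- d), d[%classic x -> `[a, b]%classic y ->
    derivable (F ^~ y) x 1.
  by move=> /Ir xr yab; have [] := dF _ _ xr yab.
have intF (x : R) : `](- d), d[%classic x -> mu.-integrable `[a, b] (EFin \o F x).
  by move=> /Ir xr; apply: continuous_integrable => t; exact: cF.
have intG : mu.-integrable `[a, b] (EFin \o (fun=> K)).
  by apply: continuous_integrable => t _; exact: cvg_cst.
have ub (x y : R) : `](- d), d[%classic x -> `[a, b]%classic y ->
    `|partial1of2 F x y| <= K.
  move=> xd yab; rewrite /partial1of2 (is_derive1E (dF _ _ (Ir _ xd) yab)).
  by apply: KF' => //; move: xd; rewrite /= in_itv /= -ltr_norml => /ltW.
apply: DeriveDef.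
  exact: (derivable_under_integral mI I0 intF derf1 (fun=> K0) intG ub).
rewrite -derive1E.
rewrite (differentiation_under_integral mI I0 intF derf1 (fun=> K0) intG ub).
apply: eq_Rintegral => t tab; rewrite /partial1of2.
by apply/is_derive1E/dF; [rewrite normr0|rewrite -inE].
Qed.
End Segment.
End Integrals.

(** * The fundamental lemma of the calculus of variations *)

Section TestFunctions.
Variable R : realType.
Local Notation mu := (@lebesgue_measure R).

(** At 0 the difference quotient with increment h is at most |h|^(n+1). *)
Lemma is_derive_pospart (n : nat) (x : R) :
  is_derive x 1 (fun y => Num.max 0 y ^+ n.+2)
    (n.+2%:R * Num.max 0 x ^+ n.+1).
Proof.
have [x0|x0|->] := ltgtP x 0.
- rewrite ?(max_l (ltW x0)) expr0n mulr0.
  apply: (near_eq_is_derive _ (is_derive_cst (0 : R) x 1)).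
  near=> y; rewrite max_l ?expr0n //.
  by apply: ltW; near: y; exact: lt_nbhsl.
- rewrite ?(max_r (ltW x0)).
  have h : is_derive x 1 (fun y : R => y ^+ n.+2) (n.+2%:R * x ^+ n.+1).
    apply: DeriveDef; first exact: exprn_derivable.
    by rewrite exp_derive /GRing.scale /= mulr1.
  apply: (near_eq_is_derive _ h).
  near=> y; rewrite max_r //.
  by apply: ltW; near: y; exact: lt_nbhsr.
- rewrite ?maxxx expr0n mulr0.
  pose f (y : R) : R := Num.max 0 y ^+ n.+2.
  have h : h^-1 *: (f (h *: 1 + 0) - f 0) @[h --> 0^'] --> (0 : R).
    apply/cvgrPdist_le => /= r r0; near=> h.
    have hr : `|h| <= r by near: h; exact: dnbhs0_le.
    have h1 : `|h| <= 1 by near: h; exact: dnbhs0_le.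
    have h0 : h != 0 by near: h; exact: nbhs_dnbhs_neq.
    rewrite /f maxxx expr0n subr0 sub0r normrN /GRing.scale /= mulr1 addr0.
    have mh : `|Num.max 0 h| <= `|h|.
      by rewrite maxEle; case: ifP => _; rewrite ?normr0.
    rewrite normrM normfV ler_pdivrMl ?normr_gt0 // normrX.
    rewrite (le_trans (lerXn2r n.+2 _ _ mh)) ?nnegrE // exprS ler_wpM2l //.
    by rewrite exprS (le_trans _ hr) // ler_piMr // exprn_ile1.
  apply: DeriveDef; first by apply/cvg_ex; exists 0.
  exact: cvg_lim.
Unshelve. all: by end_near. Qed.

(** Class C^2 suffices for the variations, and 3 is the least natural power of a
    positive part that has this regularity. *)
Definition bump (a b : R) (t : R) : R := Num.max 0 ((t - a) * (b - t)) ^+ 3.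

Lemma bumpC2 a b : C2 setT (bump a b).
Proof.
pose w (t : R) := (t - a) * (b - t); pose w' (t : R) := a + b - 2 * t.
have ww' (t : R) : is_derive t 1 w (w' t).
  have h1 : is_derive t 1 (fun t : R => t - a) (1 - 0).
    exact: is_deriveB.
  have h2 : is_derive t 1 (fun t : R => b - t) (0 - 1).
    exact: is_deriveB.
  apply: (is_derive_eq (is_derive_mul h1 h2)); rewrite /w'; ring.
have w'2 (t : R) : is_derive t 1 w' (- 2).
  have h1 : is_derive t 1 (fun t : R => 2 * t) (0 * t + 2 * 1).
    apply: (@is_derive_mul _ (fun=> 2) id); exact: is_derive_id.
  have h2 : is_derive t 1 w' (0 - (0 * t + 2 * 1)) by exact: is_deriveB.
  by apply: (is_derive_eq h2); ring.
have p2 (t : R) : is_derive t 1 (fun t : R => Num.max 0 (w t) ^+ 2)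
    (2 * Num.max 0 (w t) ^+ 1 * w' t).
  exact: (is_derive_chain (is_derive_pospart 0 _) (ww' t)).
apply: (@C2I _ _ _ _ (fun t => 3 * Num.max 0 (w t) ^+ 2 * w' t)
  (fun t => 3 * (2 * Num.max 0 (w t) ^+ 1 * w' t) * w' t +
            3 * Num.max 0 (w t) ^+ 2 * (- 2))) => [|t _|t _|t _].
- exact: openT.
- exact: (is_derive_chain (is_derive_pospart 1 _) (ww' t)).
- have h3 : is_derive t 1 (fun t : R => 3 * Num.max 0 (w t) ^+ 2)
      (0 * Num.max 0 (w t) ^+ 2 + 3 * (2 * Num.max 0 (w t) ^+ 1 * w' t)).
    by apply: (@is_derive_mul _ (fun=> 3)); exact: p2.
  by apply: (is_derive_eq (is_derive_mul h3 (w'2 t))); ring.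
- have cw : w x @[x --> t] --> w t by exact: is_derive_continuous (ww' t).
  have cw' : w' x @[x --> t] --> w' t by exact: is_derive_continuous (w'2 t).
  have cm : Num.max 0 (w x) @[x --> t] --> Num.max 0 (w t).
    apply: (@continuous_max _ _ (fun=> 0) w t _ cw); exact: cvg_cst.
  have cp : Num.max 0 (w x) ^+ 2 @[x --> t] --> Num.max 0 (w t) ^+ 2.
    exact: is_derive_continuous (p2 t).
  rewrite /prop_for /continuous_at.
  apply: cvgD; apply: cvgM => //; last exact: cvg_cst.
    apply: cvgM => //; first exact: cvg_cst.
    by apply: cvgM => //; apply: cvgM => //; exact: cvg_cst.
  by apply: cvgM => //; exact: cvg_cst.
Qed.

Lemma bump_ge0 a b t : 0 <= bump a b t.
Proof. by rewrite exprn_ge0 // le_max lexx. Qed.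

Lemma bump_out a b t : a <= b -> t \notin `]a, b[ -> bump a b t = 0.
Proof.
move=> ab; rewrite in_itv /= negb_and -!leNgt => tab.
rewrite /bump max_l ?expr0n //.
case/orP: tab => [ta|bt].
  by rewrite mulr_le0_ge0 ?subr_le0 // subr_ge0 (le_trans ta).
by rewrite mulr_ge0_le0 ?subr_le0 // subr_ge0 (le_trans _ bt).
Qed.

Lemma bump_in a b t : t \in `]a, b[ -> 0 < bump a b t.
Proof.
rewrite in_itv /= => /andP[at_ tb].
by rewrite exprn_gt0 // lt_max mulr_gt0 ?orbT // subr_gt0.
Qed.

(** On a small segment around c the function stays above h c / 2, and the
    integral over the rest of [a, b] is nonnegative. *)
Lemma Rintegral_gt0 (a b c : R) (h : R -> R) : a < b ->
  (forall t, t \in `[a, b] -> {for t, continuous h}) ->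
  (forall t, t \in `[a, b] -> 0 <= h t) -> c \in `]a, b[ -> 0 < h c ->
  0 < \int[mu]_(t in `[a, b]) h t.
Proof.
move=> ab ch h0 cab hc.
have [d d0 hd] : exists2 d : R, 0 < d & forall t, `|t - c| <= d ->
    t \in `[a, b] /\ h c / 2 <= h t.
  have h2 : 0 < h c / 2 by rewrite divr_gt0.
  have cc : h x @[x --> c] --> h c by apply: ch; exact: subset_itv_oo_cc.
  move/cvgrPdist_le : cc => /(_ _ h2) cc.
  have /nbhs_ballP[r /= r0 rh] :
      nbhs c (fun x => (x \in `]a, b[) /\ `|h c - h x| <= h c / 2).
    apply: filterI; first exact: near_in_itvoo.
    exact: cc.
  exists (r / 2); first by rewrite divr_gt0.
  move=> t tc; have [|tab /ler_normlP[_ ht]] := rh t.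
    rewrite /ball /= distrC (le_lt_trans tc) //.
    by rewrite ltr_pdivrMr // ltr_pMr // ltr1n.
  split; first exact: subset_itv_oo_cc.
  by lra.
have sub : `[c - d, c + d] `<=` `[a, b].
  move=> t /=; rewrite in_itv /= => tcd; apply: (hd t _).1.
  by rewrite ler_distl.
have ih := continuous_integrable ch.
rewrite fine_gt0 //; apply/andP; split; last first.
  by rewrite -ge0_fin_numE ?integrable_fin_num //;
     apply: integral_ge0 => t; rewrite lee_fin; exact: h0.
have mI : measurable (`[a, b]%classic : set (measurableTypeR R)) by [].
have mJ : measurable (`[c - d, c + d]%classic : set (measurableTypeR R)) by [].
have : (0 < \int[mu]_(t in `[(c - d)%R, (c + d)%R]) (h c / 2)%:E)%E.
  rewrite integral_cst // mule_gt0 ?lte_fin ?divr_gt0 //.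
  rewrite /= lebesgue_measure_itv /= lte_fin ifT; last by lra.
  by rewrite -EFinD lte_fin; lra.
move=> /lt_le_trans; apply.
have mh := measurable_int mu ih.
apply: (@le_trans _ _ (\int[mu]_(t in `[(c - d)%R, (c + d)%R]) (h t)%:E)%E).
  apply: ge0_le_integral => //.
  - by move=> t _; rewrite lee_fin divr_ge0 // ltW.
  - exact: measurable_funS mh.
  - move=> t; rewrite /= in_itv /= => ht; rewrite lee_fin.
    by apply: (hd t _).2; rewrite ler_distl.
by apply: ge0_subset_integral => // t tab; rewrite lee_fin; exact: h0.
Qed.

(** If h t0 were not 0, then h t0 * h would be positive on a small segment
    [c, d] around t0 in [a, b], and the bump over [c, d] would give a positive
    integral. *)
Lemma fundamental_lemma (a b : R) (h : R -> R) : a < b ->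
  (forall t, t \in `[a, b] -> {for t, continuous h}) ->
  (forall phi : R -> R, C2 setT phi -> phi a = 0 -> phi b = 0 ->
    \int[mu]_(t in `[a, b]) (phi t * h t) = 0) ->
  forall t, t \in `[a, b] -> h t = 0.
Proof.
move=> ab ch hphi t0 t0ab; apply/eqP/negP => /negP ht0.
have [c [d [cd sub cst_sign]]] : exists c d, [/\ c < d,
    `[c, d] `<=` `[a, b] & forall t, t \in `[c, d] -> 0 < h t0 * h t].
  have hh : 0 < h t0 * h t0 by rewrite -expr2 exprn_even_gt0.
  have chh : h t0 * h x @[x --> t0] --> h t0 * h t0.
    by apply: cvgM; [exact: cvg_cst|exact: ch].
  have /nbhs_ballP[r /= r0 rh] : nbhs t0 (fun x => 0 < h t0 * h x).
    exact: (cvgr_gt _ chh).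
  move: (t0ab); rewrite in_itv /= => /andP[at0 t0b].
  exists (Num.max a (t0 - r / 2)), (Num.min b (t0 + r / 2)); split.
  - by rewrite gt_max !lt_min; lra.
  - move=> t /=; rewrite !in_itv /= ge_max le_min.
    by move=> /andP[/andP[-> _] /andP[->]].
  - move=> t; rewrite in_itv /= ge_max le_min.
    move=> /andP[/andP[_ t1] /andP[_ t2]]; apply: rh.
    by rewrite /ball /= ltr_distl; lra.
have ac : a <= c.
  have := sub c; rewrite /= !in_itv /= lexx (ltW cd) => /(_ isT).
  by case/andP.
have db : d <= b.
  have := sub d; rewrite /= !in_itv /= lexx (ltW cd) => /(_ isT).
  by case/andP.
have phi_a : bump c d a = 0.
  by apply: bump_out (ltW cd) _; rewrite in_itv /= negb_and -!leNgt ac.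
have phi_b : bump c d b = 0.
  by apply: bump_out (ltW cd) _; rewrite in_itv /= negb_and -!leNgt db orbT.
have cphi t : t \in `[a, b] -> {for t, continuous (fun t => bump c d t * h t)}.
  move=> tab; apply: cvgM; last exact: ch.
  exact: (C1_continuous (bumpC2 c d).1).
have := hphi _ (bumpC2 c d) phi_a phi_b.
have : 0 < \int[mu]_(t in `[a, b]) (h t0 * (bump c d t * h t)).
  have m_in : (c + d) / 2 \in `]c, d[ by exact: mid_in_itvoo.
  apply: (@Rintegral_gt0 a b ((c + d) / 2)) => //.
  - by move=> t tab; apply: cvgM; [exact: cvg_cst|exact: cphi].
  - move=> t tab; rewrite /= mulrCA; have [tcd|tcd] := boolP (t \in `]c, d[).
      by rewrite mulr_ge0 ?bump_ge0 // ltW // cst_sign // subset_itv_oo_cc.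
    by rewrite bump_out ?mul0r // ltW.
  - by rewrite in_itv /=; lra.
  - by rewrite /= mulrCA mulr_gt0 ?bump_in // cst_sign // subset_itv_oo_cc.
rewrite RintegralZl //; last exact: continuous_integrable.
by move=> + h0; rewrite h0 mulr0 ltxx.
Qed.
End TestFunctions.

(** * Rotations about a fixed axis *)

Section Rotations.
Variable R : realType.
Implicit Types (v : vec3 R) (x : R).

Lemma C2_sin : C2 setT (@sin R).
Proof.
apply: (@C2I R _ setT (@sin R) (@cos R) (fun x => - sin x) openT) => x _.
by apply: cvgN; exact: continuous_sin.
Qed.

Lemma C2_versine : C2 setT (fun x : R => 1 - cos x).
Proof.
have dversine (x : R) : is_derive x 1 (fun x : R => 1 - cos x) (sin x).
  apply: (is_derive_eq (is_deriveB (is_derive_cst (1 : R) x 1)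
    (is_derive_cos x))).
  by rewrite sub0r opprK.
apply: (@C2I R _ setT (fun x => 1 - cos x) (@sin R) (@cos R) openT) => x _.
exact: continuous_cos.
Qed.

(** Rodrigues' formula for the exponential of x hat v, valid when v is a unit
    vector or 0. *)
Definition rodrigues v x : mat3 R :=
  1%:M + (sin x *: hat v + (1 - cos x) *: (hat v *m hat v)).

(** The zero vector stands for the absence of rotation.  With it, a single kind
    of test family covers the variations that move only some of the links. *)
Definition axis v := v = 0 \/ dot v v = 1.

Lemma axis_cube v : axis v -> hat v *m (hat v *m hat v) = - hat v.
Proof.
rewrite hat_cube => -[->|->]; last by rewrite scale1r.
by rewrite hat0 scaler0.
Qed.

Lemma rodrigues0 v : rodrigues v 0 = 1%:M.
Proof. by rewrite /rodrigues sin0 cos0 subrr !scale0r !addr0. Qed.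

Lemma rodrigues_tr v x : (rodrigues v x)^T = rodrigues v (- x).
Proof.
rewrite /rodrigues sinN cosN !linearD /= !linearZ /= trmx1 trmx_mul hat_tr.
by rewrite mulNmx mulmxN opprK scalerN scaleNr.
Qed.

(** As hat v has cube - hat v, the span of 1, hat v and its square is closed
    under products, and the addition formulas of sine and cosine do the rest. *)
Lemma rodriguesD v x y : axis v -> rodrigues v x *m rodrigues v y = rodrigues v (x + y).
Proof.
move=> /axis_cube HK; set H := hat v in HK *.
have KH : (H *m H) *m H = - H by rewrite -mulmxA.
have KK : (H *m H) *m (H *m H) = - (H *m H) by rewrite -mulmxA HK mulmxN.
rewrite /rodrigues -/H; set K := H *m H in HK KH KK *.
rewrite !mulmxDl !mulmxDr !mul1mx !mulmx1 -!scalemxAl -!scalemxAr HK KH KK.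
rewrite -/K sinD cosD.
by apply/matrixP => i j; rewrite !mxE; ring.
Qed.

Lemma rodrigues_orth v x : axis v -> (rodrigues v x)^T *m rodrigues v x = 1%:M.
Proof. by move=> av; rewrite rodrigues_tr rodriguesD // addNr rodrigues0. Qed.

(** The determinant is 1 because the rotation of angle x is the square of that
    of angle x / 2, whose determinant is 1 or -1. *)
Lemma rodrigues_SO3 v x : axis v -> SO3 (rodrigues v x).
Proof.
move=> av; split; first exact: rodrigues_orth.
have := congr1 determinant (rodrigues_orth (x / 2) av).
rewrite det_mulmx det_tr det1 => <-.
by rewrite -det_mulmx rodriguesD //; congr (\det (rodrigues v _)); field.
Qed.

Lemma is_derive_rodrigues v (g : R -> R) x dg : axis v -> is_derive x 1 g dg ->
  is_derive x 1 (fun y => rodrigues v (g y)) (dg *: (rodrigues v (g x) *m hat v)).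
Proof.
move=> /axis_cube v3 hg.
have h1 := is_derive_scale (is_derive_chain (is_derive_sin (g x)) hg)
  (is_derive_cst (hat v) x 1).
have h2 := is_derive_scale (is_deriveB (is_derive_cst (1 : R) x 1)
  (is_derive_chain (is_derive_cos (g x)) hg))
  (is_derive_cst (hat v *m hat v) x 1).
have h3 := is_deriveD (is_derive_cst (1%:M : mat3 R) x 1) (is_deriveD h1 h2).
apply: (is_derive_eq h3).
rewrite /rodrigues mulmxDl mul1mx mulmxDl -!scalemxAl -mulmxA v3.
by apply/matrixP => i j; rewrite !mxE; ring.
Qed.
End Rotations.

(** * The Lagrangian and its derivative *)

Section Lagrangian.
Variables (R : realType) (n : nat) (P : parameters R n).
Local Notation J := (inertia P).

Definition lagr (vx Om : vec3 R) (vq : 'I_n -> vec3 R) (x : vec3 R)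
    (q : 'I_n -> vec3 R) : R :=
  kinetic_energy P vx Om vq - potential_energy P x q.

(** The derivative of [lagr] in the direction (dvx, dOm, dvq, dx, dq).  It does
    not depend on the positions, since gravity is uniform and the kinetic energy
    is a function of the velocities alone. *)
Definition dlagr (vx Om : vec3 R) (vq : 'I_n -> vec3 R)
    (dvx dOm : vec3 R) (dvq : 'I_n -> vec3 R) (dx : vec3 R)
    (dq : 'I_n -> vec3 R) : R :=
  M00 P * dot vx dvx
  + (dot dvx (\sum_i M0 P i *: vq i) + dot vx (\sum_i M0 P i *: dvq i))
  + 2^-1 * (\sum_i \sum_j Mij P i j * (dot (dvq i) (vq j) + dot (vq i) (dvq j)))
  + 2^-1 * (dot dOm (J *m Om) + dot Om (J *m dOm))
  + (\sum_i link_weight P i * dot e3 (dq i) + M00 P * gravity P * dot e3 dx).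

Lemma lagrE vx Om vq x q : lagr vx Om vq x q =
  2^-1 * M00 P * dot vx vx + dot vx (\sum_i M0 P i *: vq i)
  + 2^-1 * (\sum_i \sum_j Mij P i j * dot (vq i) (vq j))
  + 2^-1 * dot Om (J *m Om)
  + (\sum_i link_weight P i * dot e3 (q i) + M00 P * gravity P * dot e3 x).
Proof.
by rewrite /lagr /kinetic_energy enorm_sq /potential_energy opprB opprK; ring.
Qed.

Lemma is_derive_lin_sum (c : 'I_n -> R) (vq : 'I_n -> R -> vec3 R) (e : R) dvq :
  (forall i, is_derive e 1 (vq i) (dvq i)) ->
  is_derive e 1 (fun e => \sum_i c i *: vq i e) (\sum_i c i *: dvq i).
Proof.
by move=> hq; apply: is_derive_bigsum.
Qed.

Lemma is_derive_lagr (vx Om x : R -> vec3 R) (vq q : 'I_n -> R -> vec3 R)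
    (e : R) dvx dOm dx dvq dq :
  is_derive e 1 vx dvx -> is_derive e 1 Om dOm -> is_derive e 1 x dx ->
  (forall i, is_derive e 1 (vq i) (dvq i)) ->
  (forall i, is_derive e 1 (q i) (dq i)) ->
  is_derive e 1 (fun e => lagr (vx e) (Om e) (vq ^~ e) (x e) (q ^~ e))
    (dlagr (vx e) (Om e) (vq ^~ e) dvx dOm dvq dx dq).
Proof.
move=> hvx hOm hx hvq hq.
under eq_fun do rewrite lagrE.
have h1 := is_derive_mulC (2^-1 * M00 P) (is_derive_dot hvx hvx).
have h2 := is_derive_dot hvx (is_derive_lin_sum (M0 P) hvq).
have h3 : is_derive e 1
    (fun e => 2^-1 * (\sum_i \sum_j Mij P i j * dot (vq i e) (vq j e)))
    (2^-1 * (\sum_i \sum_j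
      Mij P i j * (dot (dvq i) (vq j e) + dot (vq i e) (dvq j)))).
  apply: is_derive_mulC; apply: is_derive_bigsum => i.
  apply: is_derive_bigsum => j; apply: is_derive_mulC.
  exact: is_derive_dot.
have h4 := is_derive_mulC 2^-1 (is_derive_dot hOm
  (is_derive_mulmx (is_derive_cst J e 1) hOm)).
have h5 : is_derive e 1 (fun e => \sum_i link_weight P i * dot e3 (q i e))
    (\sum_i link_weight P i * dot e3 (dq i)).
  apply: is_derive_bigsum => i; apply: is_derive_mulC.
  apply: (is_derive_eq (is_derive_dot (is_derive_cst e3 e 1) (hq i))).
  by rewrite dot0l add0r.
have h6 : is_derive e 1 (fun e => M00 P * gravity P * dot e3 (x e))
    (M00 P * gravity P * dot e3 dx).
  apply: is_derive_mulC.
  apply: (is_derive_eq (is_derive_dot (is_derive_cst e3 e 1) hx)).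
  by rewrite dot0l add0r.
apply: (is_derive_eq (is_deriveD (is_deriveD (is_deriveD (is_deriveD h1 h2) h3) h4)
  (is_deriveD h5 h6))).
rewrite /dlagr mul0mx add0r [dot dvx (vx e)]dotC.
set a := dot (vx e) dvx; congr (_ + _ + _ + _ + _).
by field.
Qed.

Lemma dlagr_ext (vx Om dvx dOm dx vx0 Om0 dvx0 dOm0 dx0 : vec3 R)
    (vq dvq dq vq0 dvq0 dq0 : 'I_n -> vec3 R) :
  vx = vx0 -> Om = Om0 -> vq =1 vq0 -> dvx = dvx0 -> dOm = dOm0 ->
  dvq =1 dvq0 -> dx = dx0 -> dq =1 dq0 ->
  dlagr vx Om vq dvx dOm dvq dx dq =
  dlagr vx0 Om0 vq0 dvx0 dOm0 dvq0 dx0 dq0.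
Proof.
by move=> -> -> /funext -> -> -> /funext -> -> /funext ->.
Qed.

Section Limits.
Variables (T : Type) (F : set_system T).
Context {FF : Filter F}.

Lemma cvg_lagr (vx Om x : T -> vec3 R) (vq q : 'I_n -> T -> vec3 R)
    (vx0 Om0 x0 : vec3 R) (vq0 q0 : 'I_n -> vec3 R) :
  vx e @[e --> F] --> vx0 -> Om e @[e --> F] --> Om0 -> x e @[e --> F] --> x0 ->
  (forall i, vq i e @[e --> F] --> vq0 i) ->
  (forall i, q i e @[e --> F] --> q0 i) ->
  lagr (vx e) (Om e) (vq ^~ e) (x e) (q ^~ e) @[e --> F] -->
  lagr vx0 Om0 vq0 x0 q0.
Proof.
move=> hvx hOm hx hvq hq.
rewrite lagrE; under eq_fun do rewrite lagrE.
have cc (c : R) (f : T -> R) l : f e @[e --> F] --> l ->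
    c * f e @[e --> F] --> c * l.
  by move=> fl; apply: cvgM => //; exact: cvg_cst.
apply: cvgD; [apply: cvgD; [apply: cvgD; [apply: cvgD|]|]|apply: cvgD].
- by apply: (cc); exact: cvg_dot.
- apply: cvg_dot => //; apply: cvg_bigsum => i.
  by apply: cvgZ => //; exact: cvg_cst.
- apply: (cc); apply: cvg_bigsum => i; apply: cvg_bigsum => j; apply: (cc).
  exact: cvg_dot.
- apply: (cc); apply: cvg_dot => //; apply: cvg_mulmx => //; exact: cvg_cst.
- apply: cvg_bigsum => i; apply: (cc); apply: cvg_dot => //; exact: cvg_cst.
- apply: (cc); apply: cvg_dot => //; exact: cvg_cst.
Qed.

Lemma cvg_dlagr (vx Om dvx dOm dx : T -> vec3 R)
    (vq dvq dq : 'I_n -> T -> vec3 R)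
    (vx0 Om0 dvx0 dOm0 dx0 : vec3 R) (vq0 dvq0 dq0 : 'I_n -> vec3 R) :
  vx e @[e --> F] --> vx0 -> Om e @[e --> F] --> Om0 ->
  (forall i, vq i e @[e --> F] --> vq0 i) ->
  dvx e @[e --> F] --> dvx0 -> dOm e @[e --> F] --> dOm0 ->
  (forall i, dvq i e @[e --> F] --> dvq0 i) ->
  dx e @[e --> F] --> dx0 ->
  (forall i, dq i e @[e --> F] --> dq0 i) ->
  dlagr (vx e) (Om e) (vq ^~ e) (dvx e) (dOm e) (dvq ^~ e) (dx e) (dq ^~ e)
    @[e --> F] --> dlagr vx0 Om0 vq0 dvx0 dOm0 dvq0 dx0 dq0.
Proof.
move=> hvx hOm hvq hdvx hdOm hdvq hdx hdq.
have cc (c : R) (f : T -> R) l : f e @[e --> F] --> l ->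
    c * f e @[e --> F] --> c * l.
  by move=> fl; apply: cvgM => //; exact: cvg_cst.
rewrite /dlagr.
apply: cvgD; [apply: cvgD; [apply: cvgD; [apply: cvgD; [|apply: cvgD]|]|]|
  apply: cvgD].
- by apply: (cc); exact: cvg_dot.
- apply: cvg_dot => //; apply: cvg_bigsum => i.
  by apply: cvgZ => //; exact: cvg_cst.
- apply: cvg_dot => //; apply: cvg_bigsum => i.
  by apply: cvgZ => //; exact: cvg_cst.
- apply: (cc); apply: cvg_bigsum => i; apply: cvg_bigsum => j; apply: (cc).
  by apply: cvgD; exact: cvg_dot.
- apply: (cc); apply: cvgD; apply: cvg_dot => //; apply: cvg_mulmx => //;
  exact: cvg_cst.
- apply: cvg_bigsum => i; apply: (cc); apply: cvg_dot => //; exact: cvg_cst.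
- apply: (cc); apply: cvg_dot => //; exact: cvg_cst.
Qed.
End Limits.

Lemma MijC i j : Mij P i j = Mij P j i.
Proof. by rewrite /Mij maxnC -!mulrA [link_length P i * _]mulrC. Qed.

Hypothesis symJ : J^T = J.

(** Integration by parts, pointwise in time.  When x1, x2, q1, q2, Om' are the
    velocities and accelerations of a motion, and dx', dq', eta' the time
    derivatives of its variation, the right-hand side is the derivative of the
    pairing of the momenta with the variation.  On the left stand the variation
    of the Lagrangian, the work of the force F and moment T, and the residuals
    of the equations of motion.  Symmetry of the inertia matrices merges the two
    halves of the derivative of each quadratic form. *)
Lemma dlagr_by_parts (x1 x2 dx dx' Om Om' eta eta' F T : vec3 R)
    (q1 q2 dq dq' : 'I_n -> vec3 R) :
  dlagr x1 Om q1 dx' (eta' + cross Om eta) dq' dx dq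
  + (dot F dx + dot T eta)
  + (dot (M00 P *: x2 + \sum_i M0 P i *: q2 i
        - (F + (M00 P * gravity P) *: e3)) dx
     + \sum_i dot (M0 P i *: x2 + \sum_j Mij P i j *: q2 j
        - link_weight P i *: e3) (dq i)
     + dot (J *m Om' + cross Om (J *m Om) - T) eta)
  = dot (M00 P *: x2 + \sum_i M0 P i *: q2 i) dx
    + dot (M00 P *: x1 + \sum_i M0 P i *: q1 i) dx'
    + (\sum_i (dot (M0 P i *: x2 + \sum_j Mij P i j *: q2 j) (dq i)
      + dot (M0 P i *: x1 + \sum_j Mij P i j *: q1 j) (dq' i)))
    + (dot (J *m Om') eta + dot (J *m Om) eta').
Proof.
have quad : 2^-1 * (\sum_i \sum_j Mij P i j *
      (dot (dq' i) (q1 j) + dot (q1 i) (dq' j))) =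
    \sum_i dot (\sum_j Mij P i j *: q1 j) (dq' i).
  have e : \sum_i \sum_j Mij P i j * dot (q1 i) (dq' j) =
      \sum_i \sum_j Mij P i j * dot (dq' i) (q1 j).
    rewrite exchange_big; apply: eq_bigr => i _; apply: eq_bigr => j _.
    by rewrite MijC dotC.
  under eq_bigr => i _ do under eq_bigr => j _ do rewrite mulrDr.
  under eq_bigr => i _ do rewrite big_split.
  rewrite big_split /= e.
  transitivity (\sum_i \sum_j Mij P i j * dot (dq' i) (q1 j)); first by field.
  apply: eq_bigr => i _; rewrite dot_suml.
  by apply: eq_bigr => j _; rewrite dotZl dotC.
have gyro : 2^-1 * (dot (eta' + cross Om eta) (J *m Om)
      + dot Om (J *m (eta' + cross Om eta))) =
    dot (J *m Om) eta' - dot (cross Om (J *m Om)) eta.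
  have -> : dot Om (J *m (eta' + cross Om eta)) =
      dot (eta' + cross Om eta) (J *m Om).
    by rewrite dotC dot_mulmxl symJ.
  rewrite dotDl [dot (cross Om eta) _](_ : _ = - dot (cross Om (J *m Om)) eta).
    by rewrite [dot eta' _]dotC; field.
  by rewrite !coordE; ring.
have res_sum : \sum_i dot (M0 P i *: x2 + \sum_j Mij P i j *: q2 j
        - link_weight P i *: e3) (dq i) =
    \sum_i dot (M0 P i *: x2 + \sum_j Mij P i j *: q2 j) (dq i)
    - \sum_i link_weight P i * dot e3 (dq i).
  rewrite -sumrB; apply: eq_bigr => i _.
  by rewrite dotDl dotNl [dot (_ *: e3) _]dotZl.
have momenta : \sum_i dot (M0 P i *: x1 + \sum_j Mij P i j *: q1 j) (dq' i) =
    dot x1 (\sum_i M0 P i *: dq' i)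
    + \sum_i dot (\sum_j Mij P i j *: q1 j) (dq' i).
  rewrite dot_sumr -big_split; apply: eq_bigr => i _ /=.
  by rewrite dotDl dotZl dotZr.
rewrite big_split /= momenta res_sum /dlagr quad gyro !(dotDl, dotNl) !dotZl.
rewrite [dot dx' _]dotC.
by ring.
Qed.
End Lagrangian.

(** * The first variation of the action *)

Section FirstVariation.
Variable R : realType.
Local Notation mu := (@lebesgue_measure R).

(** When F is a curve of rotations and G its derivative, [vee] of F^T G is the
    angular velocity in the body frame. *)
Lemma is_derive_body_velocity (F G : R -> mat3 R) (t : R) dF dG :
  is_derive t 1 F dF -> is_derive t 1 G dG ->
  is_derive t 1 (fun x => vee ((F x)^T *m G x))
    (vee (dF^T *m G t + (F t)^T *m dG)).
Proof.
by move=> hF hG; apply/is_derive_vee/is_derive_mulmx => //; exact: is_derive_trmx.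
Qed.

Lemma cvg_body_velocity (T : Type) (F : set_system T) {FF : Filter F}
    (f g : T -> mat3 R) (A B : mat3 R) :
  f x @[x --> F] --> A -> g x @[x --> F] --> B ->
  vee ((f x)^T *m g x) @[x --> F] --> vee (A^T *m B).
Proof. by move=> fA gB; apply: cvg_vee; exact: cvg_mulmx (cvg_trmx fA) gB. Qed.

Lemma angvelE (n : nat) (D : set R) (s : motion R n) t :
  on_configuration_space D s -> D t ->
  angvel s t = vee ((att s t)^T *m derive1 (att s) t).
Proof.
by move=> conf /conf[[AA _] _ ->]; rewrite mulmxA AA mul1mx hatK.
Qed.

Lemma C1_angvel (n : nat) (D : set R) (s : motion R n) : open D ->
  on_configuration_space D s -> C2 D (att s) -> C1 D (angvel s).
Proof.
move=> oD conf [AC1 A'C1].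
apply: (C1_ext oD (fun t Dt => esym (angvelE conf Dt))).
apply: (C1I oD) => t Dt.
  exact: is_derive_body_velocity (C1_is_derive AC1 Dt) (C1_is_derive A'C1 Dt).
have cA := C1_continuous AC1 Dt; have cA' := C1_continuous A'C1 Dt.
have [_ cA''] := A'C1 _ Dt.
exact: (cvg_vee (cvgD (cvg_mulmx (cvg_trmx cA') cA')
  (cvg_mulmx (cvg_trmx cA) cA''))).
Qed.

Variables (n : nat) (P : parameters R n).
Hypothesis symJ : (inertia P)^T = inertia P.
Variables (D : set R) (t0 tf : R).
Hypotheses (oD : open D) (lt_t0tf : t0 < tf) (sub_D : `[t0, tf] `<=` D).
Variables (f : R -> R) (M : R -> vec3 R) (Dx DR : vec3 R) (s : motion R n).
Hypotheses (contf : {in D, continuous f}) (contM : {in D, continuous M}).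
Hypotheses (conf_s : on_configuration_space D s).
Hypotheses (C2x : C2 D (pos s)) (C2R : C2 D (att s))
  (C2q : forall i, C2 D (dir s i)).

Definition force t := thrust f s t + Dx.
Definition moment t := M t + DR.

(** The residuals are the Euler-Lagrange expressions, up to sign.  For a link
    the component along the link carries no information: the constraint
    |q_i| = 1 makes only q_i x dir_residual i meaningful. *)
Definition pos_residual t : vec3 R :=
  M00 P *: derive1 (derive1 (pos s)) t
  + \sum_i M0 P i *: derive1 (derive1 (dir s i)) t
  - (force t + (M00 P * gravity P) *: e3).

Definition dir_residual (i : 'I_n) t : vec3 R :=
  M0 P i *: derive1 (derive1 (pos s)) t
  + \sum_j Mij P i j *: derive1 (derive1 (dir s j)) t
  - link_weight P i *: e3.

Definition att_residual t : vec3 R :=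
  inertia P *m derive1 (angvel s) t
  + cross (angvel s t) (inertia P *m angvel s t) - moment t.

Lemma continuous_force t : D t -> {for t, continuous force}.
Proof.
move=> Dt; apply: cvgD; last exact: cvg_cst.
apply: cvgN; apply: cvgZ; first by apply: contf; rewrite inE.
apply: cvg_mulmx; last exact: cvg_cst.
exact: (C1_continuous C2R.1 Dt).
Qed.

Lemma continuous_moment t : D t -> {for t, continuous moment}.
Proof.
move=> Dt; apply: cvgD; last exact: cvg_cst.
by apply: contM; rewrite inE.
Qed.

Lemma continuous_pos_residual t : D t -> {for t, continuous pos_residual}.
Proof.
move=> Dt; apply: cvgB.
  apply: cvgD.
    by apply: cvgZ; [exact: cvg_cst|exact: (C2x.2 _ Dt).2].
  apply: cvg_bigsum => i; apply: cvgZ; first exact: cvg_cst.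
  exact: ((C2q i).2 _ Dt).2.
by apply: cvgD; [exact: continuous_force|exact: cvg_cst].
Qed.

Lemma continuous_dir_residual i t : D t -> {for t, continuous (dir_residual i)}.
Proof.
move=> Dt; apply: cvgB; last exact: cvg_cst.
apply: cvgD.
  by apply: cvgZ; [exact: cvg_cst|exact: (C2x.2 _ Dt).2].
apply: cvg_bigsum => j; apply: cvgZ; first exact: cvg_cst.
exact: ((C2q j).2 _ Dt).2.
Qed.

Lemma continuous_att_residual t : D t -> {for t, continuous att_residual}.
Proof.
move=> Dt; have OmC1 := C1_angvel oD conf_s C2R.
have cOm := C1_continuous OmC1 Dt; have [_ cOm'] := OmC1 _ Dt.
have cJ : inertia P @[_ --> t] --> inertia P by exact: cvg_cst.
apply: cvgB; last exact: continuous_moment.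
apply: cvgD; first exact: cvg_mulmx.
by apply: cvg_cross => //; exact: cvg_mulmx.
Qed.

Definition residual_work (dx eta : R -> vec3 R) (dq : 'I_n -> R -> vec3 R) t :=
  dot (pos_residual t) (dx t) + \sum_i dot (dir_residual i t) (dq i t)
  + dot (att_residual t) (eta t).

(** With G the pairing of the momenta with the variation, [dlagr_by_parts] says
    that the derivative of the Lagrangian along the family at e = 0, plus the
    virtual work and the work of the residuals, is the time derivative of G.
    The integral of the latter is 0, as G vanishes at both end points. *)
Lemma first_variation (r : R) (V : R -> motion R n) (eta : R -> vec3 R) :
  is_variation D r s V ->
  (forall t, D t -> delta_att V t = att s t *m hat (eta t)) ->
  (forall t, t = t0 \/ t = tf ->
    [/\ delta_pos V t = 0, eta t = 0 & forall i, delta_dir V i t = 0]) ->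
  is_derive (0 : R) (1 : R) (fun e => action P t0 tf (V e))
    (- virtual_work f M Dx DR t0 tf s (delta_pos V) eta
     - \int[mu]_(t in `[t0, tf])
         residual_work (delta_pos V) eta (delta_dir V) t).
Proof.
move=> [r0 V0 confV [XC2 AC2 QC2]] heta hend.
set E := [set e : R | `|e| < r] in confV XC2 AC2 QC2.
have E0 : E 0 by rewrite /E /= normr0.
have oE : open E.
  rewrite (_ : E = ball (0 : R) r); first exact: ball_open.
  by apply/seteqP; split=> x /=; rewrite /ball /= sub0r normrN.
pose X e := pos (V e); pose A e := att (V e); pose Q i e := dir (V e) i.
have {}XC2 : jointC2 E D X by []. have {}AC2 : jointC2 E D A by [].
have {}QC2 i : jointC2 E D (Q i) by exact: QC2.
have [XC1 XeC1 XtC1] := XC2; have [AC1 AeC1 AtC1] := AC2.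
have QC1 i : jointC1 E D (Q i) by have [] := QC2 i.
have QeC1 i : jointC1 E D (d_eps (Q i)) by have [] := QC2 i.
have QtC1 i : jointC1 E D (d_time (Q i)) by have [] := QC2 i.
(* Only on E x D is Om the angular velocity of the family; the formula makes its
   regularity visible. *)
pose Om e t := vee ((A e t)^T *m d_time A e t).
pose dOm e t := vee ((d_eps A e t)^T *m d_time A e t
                     + (A e t)^T *m d_eps (d_time A) e t).
pose L e t := lagr P (d_time X e t) (Om e t) (fun i => d_time (Q i) e t)
  (X e t) (fun i => Q i e t).
pose dL e t := dlagr P (d_time X e t) (Om e t) (fun i => d_time (Q i) e t)
  (d_eps (d_time X) e t) (dOm e t) (fun i => d_eps (d_time (Q i)) e t)
  (d_eps X e t) (fun i => d_eps (Q i) e t).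
have LE e t : E e -> D t -> lagrangian P (V e) t = L e t.
  by move=> Ee Dt; rewrite /lagrangian (angvelE (confV e Ee) Dt).
have derL e t : E e -> D t -> is_derive e 1 (L ^~ t) (dL e t).
  move=> Ee Dt.
  apply: (@is_derive_lagr _ _ _ (d_time X ^~ t) (Om ^~ t) (X ^~ t)
    (fun i => d_time (Q i) ^~ t) (fun i => Q i ^~ t)).
  - exact: jointC1_eps XtC1 Ee Dt.
  - exact: is_derive_body_velocity (jointC1_eps AC1 Ee Dt)
      (jointC1_eps AtC1 Ee Dt).
  - exact: jointC1_eps XC1 Ee Dt.
  - by move=> i; exact: jointC1_eps (QtC1 i) Ee Dt.
  - by move=> i; exact: jointC1_eps (QC1 i) Ee Dt.
have contdL e t : E e -> D t ->
    {for (e, t), continuous (fun p : R * R => dL p.1 p.2)}.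
  move=> Ee Dt.
  have [_ _ cXe cXt] := XC1 _ _ Ee Dt; have [_ _ cXte _] := XtC1 _ _ Ee Dt.
  have [_ _ cAe cAt] := AC1 _ _ Ee Dt; have [_ _ cAte _] := AtC1 _ _ Ee Dt.
  have cA := jointC1_continuous oE oD AC1 Ee Dt.
  have cOm : Om p.1 p.2 @[p --> (e, t)] --> Om e t.
    exact: cvg_body_velocity cA cAt.
  have cdOm : dOm p.1 p.2 @[p --> (e, t)] --> dOm e t.
    exact: (cvg_vee (cvgD (cvg_mulmx (cvg_trmx cAe) cAt)
      (cvg_mulmx (cvg_trmx cA) cAte))).
  have cQt i : d_time (Q i) p.1 p.2 @[p --> (e, t)] --> d_time (Q i) e t.
    by have [_ _ _] := QC1 i _ _ Ee Dt.
  have cQte i : d_eps (d_time (Q i)) p.1 p.2 @[p --> (e, t)] -->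
      d_eps (d_time (Q i)) e t.
    by have [_ _ h _] := QtC1 i _ _ Ee Dt; exact: h.
  have cQe i : d_eps (Q i) p.1 p.2 @[p --> (e, t)] --> d_eps (Q i) e t.
    by have [_ _ h _] := QC1 i _ _ Ee Dt; exact: h.
  exact: (cvg_dlagr cXt cOm cQt cXte cdOm cQte cXe cQe).
have contL e t : E e -> D t -> {for t, continuous (L e)}.
  move=> Ee Dt.
  have cA := is_derive_continuous (jointC1_time AC1 Ee Dt).
  have cAt := is_derive_continuous (jointC1_time AtC1 Ee Dt).
  have cOm : {for t, continuous (Om e)} by exact: cvg_body_velocity cA cAt.
  have cX := is_derive_continuous (jointC1_time XC1 Ee Dt).
  have cXt := is_derive_continuous (jointC1_time XtC1 Ee Dt).
  have cQ i := is_derive_continuous (jointC1_time (QC1 i) Ee Dt).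
  have cQt i := is_derive_continuous (jointC1_time (QtC1 i) Ee Dt).
  exact: (cvg_lagr cXt cOm cX cQt cQ).
have DI t : t \in `[t0, tf] -> D t by exact: sub_D.
have der_action : is_derive (0 : R) (1 : R) (fun e => action P t0 tf (V e))
    (\int[mu]_(t in `[t0, tf]) dL 0 t).
  apply: (is_derive_ext oE E0 (f := fun e => \int[mu]_(t in `[t0, tf]) L e t)).
    move=> e Ee; apply: eq_Rintegral => t; rewrite inE => /DI Dt.
    by rewrite LE.
  apply: (@is_derive_Rintegral R t0 tf r L dL r0) => e t Ee /DI Dt.
  - exact: derL.
  - exact: contdL.
  - exact: contL.
apply: (is_derive_eq der_action).
pose W t := dot (force t) (delta_pos V t) + dot (moment t) (eta t).
pose p_x t := M00 P *: derive1 (pos s) t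
  + \sum_i M0 P i *: derive1 (dir s i) t.
pose p_q i t := M0 P i *: derive1 (pos s) t
  + \sum_j Mij P i j *: derive1 (dir s j) t.
pose G t := dot (p_x t) (delta_pos V t)
  + (\sum_i dot (p_q i t) (delta_dir V i t))
  + dot (inertia P *m angvel s t) (eta t).
have X0 : X 0 = pos s by rewrite /X V0.
have A0 : A 0 = att s by rewrite /A V0.
have Q0 i : Q i 0 = dir s i by rewrite /Q V0.
have d_timeE (W' : normedModType R) (u : R -> R -> W') e :
  d_time u e = derive1 (u e) by [].
have Om0 t : D t -> Om 0 t = angvel s t.
  by move=> Dt; rewrite /Om d_timeE A0 -(angvelE conf_s Dt).
(* Differentiating hat eta = A^T dA in time gives the derivative of eta. *)
pose deta t := vee ((derive1 (att s) t)^T *m delta_att V t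
  + (att s t)^T *m d_time (d_eps A) 0 t).
have etaE t : D t -> vee ((att s t)^T *m delta_att V t) = eta t.
  move=> Dt; have [[AA _] _ _] := conf_s Dt.
  by rewrite heta // mulmxA AA mul1mx hatK.
have der_eta t : D t -> is_derive t 1 eta (deta t).
  move=> Dt; apply: (is_derive_ext oD Dt etaE).
  exact: is_derive_body_velocity (C1_is_derive C2R.1 Dt)
    (jointC1_time AeC1 E0 Dt).
(* Mixed derivatives of A commute, so the two expressions
   A hat eta and A hat Om for its partial derivatives give a commutator of hats. *)
have dOm0 t : D t -> dOm 0 t = deta t + cross (angvel s t) (eta t).
  move=> Dt; rewrite /dOm /deta (schwarz oE oD AC2 E0 Dt) d_timeE A0.
  have -> : d_eps A 0 t = delta_att V t by [].
  move: (d_time (d_eps A) 0 t) => AA'.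
  have [[AA _] _ ->] := conf_s Dt; rewrite heta //.
  rewrite !trmx_mul !hat_tr !mulmxA -!(mulmxA _ _ (att s t)) AA !mulmx1.
  rewrite -(hatK (cross _ _)) -hat_comm -veeD; congr vee.
  by rewrite !mulNmx addrAC addrA addNr add0r addrC.
have der_dx t : D t -> is_derive t 1 (delta_pos V) (d_time (d_eps X) 0 t).
  exact: jointC1_time XeC1 E0.
have der_dq i t : D t ->
    is_derive t 1 (delta_dir V i) (d_time (d_eps (Q i)) 0 t).
  exact: jointC1_time (QeC1 i) E0.
have der_x' t : D t ->
    is_derive t 1 (derive1 (pos s)) (derive1 (derive1 (pos s)) t).
  exact: C1_is_derive C2x.2.
have der_q' i t : D t ->
    is_derive t 1 (derive1 (dir s i)) (derive1 (derive1 (dir s i)) t).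
  exact: C1_is_derive (C2q i).2.
have der_Om t : D t -> is_derive t 1 (angvel s) (derive1 (angvel s) t).
  exact: C1_is_derive (C1_angvel oD conf_s C2R).
pose RW t := residual_work (delta_pos V) eta (delta_dir V) t.
have dLE t : D t -> dL 0 t = dlagr P (derive1 (pos s) t) (angvel s t)
    (fun i => derive1 (dir s i) t) (d_time (d_eps X) 0 t)
    (deta t + cross (angvel s t) (eta t))
    (fun i => d_time (d_eps (Q i)) 0 t) (delta_pos V t)
    (fun i => delta_dir V i t).
  move=> Dt; apply: dlagr_ext.
  - by rewrite d_timeE X0.
  - exact: Om0.
  - by move=> i; rewrite d_timeE Q0.
  - exact: (schwarz oE oD XC2 E0 Dt).
  - exact: dOm0.
  - move=> i; exact: (schwarz oE oD (QC2 i) E0 Dt).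
  - by [].
  - by [].
have der_G t : D t -> is_derive t 1 G (dL 0 t + W t + RW t).
  move=> Dt; rewrite dLE // /RW /residual_work /W.
  rewrite (dlagr_by_parts symJ).
  have der_px : is_derive t 1 p_x (M00 P *: derive1 (derive1 (pos s)) t
      + \sum_i M0 P i *: derive1 (derive1 (dir s i)) t).
    exact: (is_deriveD (is_deriveZ (M00 P) (der_x' _ Dt))
      (is_derive_lin_sum (M0 P) (fun i => der_q' i _ Dt))).
  have der_pq i : is_derive t 1 (p_q i) (M0 P i *: derive1 (derive1 (pos s)) t
      + \sum_j Mij P i j *: derive1 (derive1 (dir s j)) t).
    exact: (is_deriveD (is_deriveZ (M0 P i) (der_x' _ Dt))
      (is_derive_lin_sum (Mij P i) (fun j => der_q' j _ Dt))).
  have der_JOm : is_derive t 1 (fun t => inertia P *m angvel s t)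
      (inertia P *m derive1 (angvel s) t).
    apply: (is_derive_eq (is_derive_mulmx (is_derive_cst (inertia P) t 1)
      (der_Om _ Dt))).
    by rewrite mul0mx add0r.
  exact: (is_deriveD (is_deriveD (is_derive_dot der_px (der_dx _ Dt))
    (is_derive_bigsum _ _ (fun i => is_derive_dot (der_pq i) (der_dq i _ Dt))))
    (is_derive_dot der_JOm (der_eta _ Dt))).
have cdL t : t \in `[t0, tf] -> {for t, continuous (dL 0)}.
  move=> /DI Dt.
  have c0 : (0 : R, x) @[x --> t] --> (0 : R, t).
    apply: (@cvg_pair _ _ _ _ (nbhs (0 : R)) (nbhs t)); last exact: cvg_id.
    exact: cvg_cst.
  have cdL0 := contdL _ _ E0 Dt.
  apply: (@cvg_comp _ _ _ (fun x : R => (0 : R, x))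
    (fun p : R * R => dL p.1 p.2) _ (nbhs (0 : R, t))); first exact: c0.
  exact: cdL0.
have cdx t : D t -> {for t, continuous (delta_pos V)}.
  by move=> Dt; exact: is_derive_continuous (der_dx _ Dt).
have cdq i t : D t -> {for t, continuous (delta_dir V i)}.
  by move=> Dt; exact: is_derive_continuous (der_dq i _ Dt).
have ceta t : D t -> {for t, continuous eta}.
  by move=> Dt; exact: is_derive_continuous (der_eta _ Dt).
have cW t : t \in `[t0, tf] -> {for t, continuous W}.
  move=> /DI Dt.
  exact: (cvgD (cvg_dot (continuous_force Dt) (cdx _ Dt))
    (cvg_dot (continuous_moment Dt) (ceta _ Dt))).
have cRW t : t \in `[t0, tf] -> {for t, continuous RW}.
  move=> /DI Dt.
  have cS : {for t, continuous (fun t =>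
      \sum_i dot (dir_residual i t) (delta_dir V i t))}.
    apply: (@cvg_bigsum _ _ _ _ _ _ _ _
      (fun i t => dot (dir_residual i t) (delta_dir V i t))) => i.
    exact: (cvg_dot (continuous_dir_residual (i := i) Dt) (cdq i _ Dt)).
  exact: (cvgD (cvgD (cvg_dot (continuous_pos_residual Dt) (cdx _ Dt)) cS)
    (cvg_dot (continuous_att_residual Dt) (ceta _ Dt))).
have G0 t : t = t0 \/ t = tf -> G t = 0.
  move=> /hend[dx0 eta0 dq0]; rewrite /G dx0 eta0 !dot0r big1 ?addr0 // => i _.
  by rewrite dq0 dot0r.
have cdLW t : t \in `[t0, tf] -> {for t, continuous (fun t => dL 0 t + W t)}.
  by move=> tI; exact: (cvgD (cdL _ tI) (cW _ tI)).
have : \int[mu]_(t in `[t0, tf]) (dL 0 t + W t + RW t) = 0.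
  have -> := @Rintegral_derive R t0 tf lt_t0tf G
    (fun t => dL 0 t + W t + RW t) (fun t tI => der_G t (DI t tI))
    (fun t tI => cvgD (cdLW t tI) (cRW t tI)).
  by rewrite (G0 t0 (or_introl erefl)) (G0 tf (or_intror erefl)) subrr.
rewrite RintegralD //; try exact: continuous_integrable.
rewrite RintegralD //; try exact: continuous_integrable.
move=> /eqP; rewrite -addrA addr_eq0 => /eqP ->.
by rewrite opprD.
Qed.
End FirstVariation.

(** * Stationary motions *)

Section TestFamily.
Variable R : realType.
Local Notation mu := (@lebesgue_measure R).

Lemma S2_rot (v q : vec3 R) x : axis v -> S2 q -> S2 (rodrigues v x *m q).
Proof.
by move=> av; rewrite /S2 /= /enorm dot_mul_orth //; exact: rodrigues_orth.
Qed.

(** The translation e phi(t) a of the quadrotor, combined with rotations by the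
    angle e phi(t) of its attitude about v in the body frame and of link i about
    w i in the inertial frame.  The angular velocity follows from the product
    rule; stated by a formula at all times, it makes the family equal to s at
    e = 0 even at times where s is not assumed to be a motion. *)
Definition test_family n (s : motion R n) (a v : vec3 R) (w : 'I_n -> vec3 R)
    (phi : R -> R) (e : R) : motion R n :=
  Motion (fun t => pos s t + (e * phi t) *: a)
    (fun t => att s t *m rodrigues v (e * phi t))
    (fun t => (rodrigues v (e * phi t))^T *m angvel s t + (e * derive1 phi t) *: v)
    (fun i t => rodrigues (w i) (e * phi t) *m dir s i t).

Variables (n : nat) (D : set R) (s : motion R n).
Hypotheses (oD : open D) (conf_s : on_configuration_space D s).
Hypotheses (C2x : C2 D (pos s)) (C2R : C2 D (att s))
  (C2q : forall i, C2 D (dir s i)).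
Variables (a v : vec3 R) (w : 'I_n -> vec3 R) (phi : R -> R).
Hypotheses (av : axis v) (aw : forall i, axis (w i)) (C2phi : C2 setT phi).
Let V := test_family s a v w phi.

Lemma test_family0 : V 0 = s.
Proof.
rewrite /V /test_family; case: s => x A Om q /=.
congr Motion; apply/funext => t; rewrite ?mul0r ?scale0r ?addr0 //.
- by rewrite rodrigues0 mulmx1.
- by rewrite rodrigues0 trmx1 mul1mx.
- by apply/funext => u; rewrite mul0r rodrigues0 mul1mx.
Qed.

Lemma is_derive_scaled_phi (e t : R) :
  is_derive t 1 (fun t => e * phi t) (e * derive1 phi t).
Proof. exact: is_derive_mulC (C1_is_derive C2phi.1 I). Qed.

Lemma test_family_conf e : on_configuration_space D (V e).
Proof.
move=> t Dt; have [AS qS A'] := conf_s Dt; split => /=.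
- exact: SO3M AS (rodrigues_SO3 _ av).
- by move=> i; exact: S2_rot.
- have hr := is_derive_rodrigues av (is_derive_scaled_phi e t).
  rewrite /V /test_family /=.
  rewrite (is_derive1E (is_derive_mulmx (C1_is_derive C2R.1 Dt) hr)) A'.
  move: (rodrigues_SO3 (e * phi t) av) => {hr}.
  move: (rodrigues v _) => B SB; rewrite hatD hatZ -!mulmxA [B *m (_ + _)]mulmxDr.
  by rewrite hat_mul_SO3 // -!scalemxAr mulmxDr scalemxAr.
Qed.

Lemma jointC2_rot_coeffs (E : set R) (oE : open E) :
  jointC2 E D (fun e t => sin (e * phi t)) /\
  jointC2 E D (fun e t => 1 - cos (e * phi t)).
Proof.
have h : jointC2 E D (fun e t => e * phi t).
  by apply: jointC2_linear => //; exact: C2_subset C2phi.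
by split; [exact: (jointC2_comp oE oD (C2_sin R) h)
          |exact: (jointC2_comp oE oD (C2_versine R) h)].
Qed.

Lemma test_family_variation : is_variation D 1 s V.
Proof.
have oE : open [set e : R | `|e| < 1].
  rewrite (_ : [set e | _] = ball (0 : R) 1); first exact: ball_open.
  by apply/seteqP; split=> x /=; rewrite /ball /= sub0r normrN.
have [hsin hcos] := jointC2_rot_coeffs oE.
split; [exact: ltr01|exact: test_family0| |split].
- by move=> e _; exact: test_family_conf.
- have hlin : jointC2 [set e : R | `|e| < 1] D (fun e t => e * phi t).
    exact: (jointC2_linear oE oD (C2_subset (@subsetT _ D) C2phi)).
  exact: (jointC2D oE oD (jointC2_static oE oD C2x)
    (jointC2Z oE oD hlin (jointC2_static oE oD (C2_cst a oD)))).
- rewrite (_ : (fun e => att (V e)) = fun e t => att s t +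
      (sin (e * phi t) *: (att s t *m hat v) +
       (1 - cos (e * phi t)) *: (att s t *m (hat v *m hat v)))); last first.
    apply/funext => e; apply/funext => t /=.
    by rewrite /rodrigues !mulmxDr mulmx1 -!scalemxAr.
  apply: (jointC2D oE oD (jointC2_static oE oD C2R)).
  apply: (jointC2D oE oD).
    by apply: (jointC2Z oE oD hsin); exact: (jointC2_static oE oD (C2_mulmxr _ oD C2R)).
  by apply: (jointC2Z oE oD hcos); exact: (jointC2_static oE oD (C2_mulmxr _ oD C2R)).
- move=> i.
  rewrite (_ : (fun e => dir (V e) i) = fun e t => dir s i t +
      (sin (e * phi t) *: (hat (w i) *m dir s i t) +
       (1 - cos (e * phi t)) *: ((hat (w i) *m hat (w i)) *m dir s i t)));
    last first.
    apply/funext => e; apply/funext => t /=.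
    by rewrite /rodrigues !mulmxDl mul1mx -!scalemxAl.
  apply: (jointC2D oE oD (jointC2_static oE oD (C2q i))).
  apply: (jointC2D oE oD).
    by apply: (jointC2Z oE oD hsin);
       exact: (jointC2_static oE oD (C2_mulmxl _ oD (C2q i))).
  by apply: (jointC2Z oE oD hcos);
     exact: (jointC2_static oE oD (C2_mulmxl _ oD (C2q i))).
Qed.

Lemma is_derive_eps_phi t : is_derive (0 : R) 1 (fun e => e * phi t) (phi t).
Proof.
apply: (is_derive_eq (is_derive_mul (is_derive_id (0 : R) 1)
  (is_derive_cst (phi t) (0 : R) 1))).
by rewrite mulr0 addr0 mul1r.
Qed.

Lemma delta_pos_test t : delta_pos V t = phi t *: a.
Proof.
apply: is_derive1E.
apply: (is_derive_eq (is_deriveD (is_derive_cst (pos s t) (0 : R) 1)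
  (is_derive_scale (is_derive_eps_phi t) (is_derive_cst a (0 : R) 1)))).
by rewrite scaler0 addr0 add0r.
Qed.

Lemma delta_att_test t : delta_att V t = att s t *m hat (phi t *: v).
Proof.
apply: is_derive1E.
apply: (is_derive_eq (is_derive_mulmx (is_derive_cst (att s t) (0 : R) 1)
  (is_derive_rodrigues av (is_derive_eps_phi t)))).
by rewrite mul0mx add0r mul0r rodrigues0 mul1mx hatZ.
Qed.

Lemma delta_dir_test i t : delta_dir V i t = cross (phi t *: w i) (dir s i t).
Proof.
apply: is_derive1E.
apply: (is_derive_eq (is_derive_mulmx
  (is_derive_rodrigues (aw i) (is_derive_eps_phi t))
  (is_derive_cst (dir s i t) (0 : R) 1))).
by rewrite mulmx0 addr0 mul0r rodrigues0 mul1mx -scalemxAl hatE crossZl.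
Qed.
End TestFamily.

Section StationaryMotions.
Variable R : realType.
Local Notation mu := (@lebesgue_measure R).
Variables (n : nat) (P : parameters R n).
Hypothesis symJ : (inertia P)^T = inertia P.
Variables (D : set R) (t0 tf : R).
Hypotheses (oD : open D) (lt_t0tf : t0 < tf) (sub_D : `[t0, tf] `<=` D).
Variables (f : R -> R) (M : R -> vec3 R) (Dx DR : vec3 R) (s : motion R n).
Hypotheses (contf : {in D, continuous f}) (contM : {in D, continuous M}).
Hypotheses (conf_s : on_configuration_space D s).
Hypotheses (C2x : C2 D (pos s)) (C2R : C2 D (att s))
  (C2q : forall i, C2 D (dir s i)).

Local Notation pos_res := (pos_residual P f Dx s).
Local Notation dir_res := (dir_residual P s).
Local Notation att_res := (att_residual P M DR s).

(** The test family of a function phi turns the principle into: phi times the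
    expression below has integral 0.  The link term appears through
    B . (w x q) = w . (q x B). *)
Lemma stationary_tested (a v : vec3 R) (w : 'I_n -> vec3 R) :
  axis v -> (forall i, axis (w i)) ->
  lagrange_dAlembert P f M Dx DR D t0 tf s ->
  forall t, t \in `[t0, tf] ->
    dot a (pos_res t) + \sum_i dot (w i) (cross (dir s i t) (dir_res i t))
    + dot v (att_res t) = 0.
Proof.
move=> av aw lda.
have DI t : t \in `[t0, tf] -> D t by exact: sub_D.
apply: (@fundamental_lemma R t0 tf (fun t => dot a (pos_res t)
  + \sum_i dot (w i) (cross (dir s i t) (dir_res i t))
  + dot v (att_res t))) => //.
  move=> t /DI Dt.
  have cS : {for t, continuous (fun t =>
      \sum_i dot (w i) (cross (dir s i t) (dir_res i t)))}.
    apply: (@cvg_bigsum _ _ _ _ _ _ _ _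
      (fun i t => dot (w i) (cross (dir s i t) (dir_res i t)))) => i.
    have cB : {for t, continuous (dir_res i)}.
      exact: (continuous_dir_residual C2x C2q Dt).
    have cq : {for t, continuous (dir s i)} := C1_continuous (C2q i).1 Dt.
    exact: (cvg_dot (cvg_cst (w i)) (cvg_cross cq cB)).
  have cp : {for t, continuous pos_res}.
    exact: (continuous_pos_residual contf C2x C2R C2q Dt).
  have ca : {for t, continuous att_res}.
    exact: (continuous_att_residual oD contM conf_s C2R Dt).
  exact: (cvgD (cvgD (cvg_dot (cvg_cst a) cp) cS) (cvg_dot (cvg_cst v) ca)).
move=> phi C2phi phi0 phif.
pose V := test_family s a v w phi.
have hV : is_variation D 1 s V by exact: test_family_variation.
pose eta t := phi t *: v.
(* The component of w i along the link does not move it; it is removed because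
   infinitesimal rotations of a link have to be orthogonal to it. *)
pose xi i t := phi t *: (w i - dot (w i) (dir s i t) *: dir s i t).
have hatt t : D t -> delta_att V t = att s t *m hat (eta t).
  by move=> _; exact: delta_att_test.
have hxi i t : D t -> delta_dir V i t = cross (xi i t) (dir s i t) /\
    dot (xi i t) (dir s i t) = 0.
  move=> Dt; have [_ /(_ i)/S2E qq _] := conf_s Dt.
  rewrite delta_dir_test // /xi; split.
    rewrite !crossZl crossDl -scaleNr crossZl.
    rewrite (_ : cross (dir s i t) (dir s i t) = 0) ?scaler0 ?addr0 //.
    by apply: vec3P; rewrite !(coordE, mxE); ring.
  by rewrite dotZl dotDl dotNl dotZl qq mulr1 subrr mulr0.
have hend t : t = t0 \/ t = tf ->
    [/\ delta_pos V t = 0, eta t = 0 & forall i, xi i t = 0].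
  move=> tb; have phit : phi t = 0 by case: tb => ->.
  by rewrite delta_pos_test // /eta /xi phit !scale0r; split=> // i; rewrite scale0r.
have hend' t : t = t0 \/ t = tf ->
    [/\ delta_pos V t = 0, eta t = 0 & forall i, delta_dir V i t = 0].
  move=> tb; have phit : phi t = 0 by case: tb => ->.
  have [-> -> _] := hend t tb; split=> // i.
  by rewrite delta_dir_test // phit scale0r cross0l.
have h1 := lda _ _ _ _ hV hatt hxi hend.
have h2 := first_variation symJ oD lt_t0tf sub_D Dx DR contf contM conf_s C2x C2R C2q
  hV hatt hend'.
have := is_derive_unique h1 h2.
move=> /eqP; rewrite -subr_eq0 opprB addrA addrC addrA addNr add0r => /eqP RW0.
rewrite -[RHS]RW0.
apply: eq_Rintegral => t; rewrite inE => /DI Dt.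
rewrite /residual_work delta_pos_test // /eta [dot _ (phi t *: a)]dotC.
rewrite [dot _ (phi t *: v)]dotC !dotZl !mulrDr; congr (_ + _ + _).
rewrite mulr_sumr; apply: eq_bigr => i _; rewrite delta_dir_test // crossZl dotZr.
by rewrite [dot (dir_res i t) _]dot_cross.
Qed.

(** Testing with one basis vector among a, v and the w i, and 0 for the others,
    isolates the coordinates of the three kinds of residuals. *)
Lemma lagrange_dAlembertP :
  lagrange_dAlembert P f M Dx DR D t0 tf s <->
  (forall t, t \in `[t0, tf] -> [/\ pos_res t = 0,
    forall i, cross (dir s i t) (dir_res i t) = 0 & att_res t = 0]).
Proof.
have DI t : t \in `[t0, tf] -> D t by exact: sub_D.
split=> [lda t tI|res0 r V eta xi hV hatt hxi hend].
  have axis0 : axis (0 : vec3 R) by left.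
  have axis_delta k : axis (delta_mx k 0 : vec3 R).
    by right; rewrite dot_delta mxE !eqxx.
  split.
  - apply: dot_eq0 => k.
    have := stationary_tested (delta_mx k 0) axis0 (fun=> axis0) lda tI.
    by rewrite dot0l addr0 big1 ?addr0 // => i _; rewrite dot0l.
  - move=> i; apply: dot_eq0 => k.
    pose w j : vec3 R := if j == i then delta_mx k 0 else 0.
    have aw j : axis (w j) by rewrite /w; case: ifP.
    have := stationary_tested 0 axis0 aw lda tI.
    rewrite !dot0l addr0 add0r (bigD1 i) //= big1 ?addr0 /w ?eqxx // => j.
    by move=> /negPf ->; rewrite dot0l.
  - apply: dot_eq0 => k.
    have := stationary_tested 0 (axis_delta k) (fun=> axis0) lda tI.
    by rewrite dot0l add0r big1 ?add0r // => i _; rewrite dot0l.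
have hend' t : t = t0 \/ t = tf ->
    [/\ delta_pos V t = 0, eta t = 0 & forall i, delta_dir V i t = 0].
  move=> tb; have [-> -> xi0] := hend t tb; split=> // i.
  have Dt : D t.
    by apply: DI; case: tb => ->; rewrite in_itv /= lexx ltW.
  by have [-> _] := hxi i t Dt; rewrite xi0 cross0l.
apply: (is_derive_eq (first_variation symJ oD lt_t0tf sub_D Dx DR contf contM conf_s
  C2x C2R C2q hV hatt hend')).
rewrite (_ : \int[mu]_(t in _) _ = 0) ?subr0 //.
rewrite (_ : \int[mu]_(t in _) _ = \int[mu]_(t in `[t0, tf]) (0 : R)).
  by rewrite Rintegral_cst // mul0r.
apply: eq_Rintegral => t; rewrite inE => tI.
have [p0 q0 a0] := res0 t tI.
rewrite /residual_work p0 a0 !dot0l addr0 add0r big1 // => i _.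
by have [-> _] := hxi i t (DI t tI); rewrite dot_cross q0 dot0r.
Qed.
End StationaryMotions.

(** * The equation of a link *)

Section LinkEquations.
Variable R : realType.
Implicit Types q Y Z : vec3 R.

Lemma cross_crossK q Y : dot q q = 1 ->
  cross q (cross q (cross q Y)) = - cross q Y.
Proof.
by move=> qq; rewrite cross_cross dot_crossl scale0r qq scale1r add0r.
Qed.

(** The unit length of q and q . q2 = - |q1|^2 give
    q2 + |q1|^2 q = - q x (q x q2), so the two sides of the equation differ by
    - q x Z, where Z is the left-hand side of the last equality.  As Z is
    orthogonal to q, it vanishes with q x Z. *)
Lemma link_equationP (m w : R) q q1 q2 Y : dot q q = 1 ->
  dot q q2 = - dot q1 q1 ->
  (m *: q2 - hat q ^+ 2 *m Y
     = - ((m * enorm q1 ^+ 2) *: q) - w *: (hat q ^+ 2 *m e3)) <->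
  cross q (Y + m *: q2 - w *: e3) = 0.
Proof.
move=> qq qq2; set Z := cross q _.
have diffE : m *: q2 - hat q ^+ 2 *m Y
    - (- ((m * enorm q1 ^+ 2) *: q) - w *: (hat q ^+ 2 *m e3)) = - cross q Z.
  rewrite !hat_sqE enorm_sq /Z !crossDr -scaleNr !crossZr.
  rewrite [cross q (cross q q2)]cross_cross qq scale1r qq2.
  by apply/colP => k; rewrite !mxE; ring.
split=> [|Z0].
  move=> /eqP; rewrite -subr_eq0 diffE oppr_eq0 => /eqP qZ0.
  by rewrite -[Z]opprK -(cross_crossK _ qq) -/Z qZ0 cross0r oppr0.
by apply/eqP; rewrite -subr_eq0 diffE Z0 cross0r oppr0.
Qed.

Lemma angular_velocityE q (om q1 : vec3 R) : dot q q = 1 -> dot q om = 0 ->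
  q1 = cross om q -> om = cross q q1.
Proof.
by move=> qq qom ->; rewrite cross_cross qq qom scale1r scale0r subr0.
Qed.

Section Motion.
Variables (D : set R) (q om : R -> vec3 R).
Hypotheses (oD : open D) (C2q : C2 D q) (Sq : forall t, D t -> dot (q t) (q t) = 1).

Lemma is_derive_constant (f : R -> R) (c t df : R) :
  D t -> (forall x, D x -> f x = c) -> is_derive t 1 f df -> df = 0.
Proof.
move=> Dt fc hf; apply: (is_derive_unique hf).
by apply: (is_derive_ext oD Dt _ (is_derive_cst c t 1)) => x Dx; rewrite fc.
Qed.

Lemma dot_velocity t : D t -> dot (q t) (derive1 q t) = 0.
Proof.
move=> Dt; have hq := C1_is_derive C2q.1 Dt.
have /eqP := is_derive_constant Dt Sq (is_derive_dot hq hq).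
by rewrite [dot (derive1 q t) _]dotC -mulr2n mulrn_eq0 => /eqP.
Qed.

Lemma dot_acceleration t : D t ->
  dot (q t) (derive1 (derive1 q) t) = - dot (derive1 q t) (derive1 q t).
Proof.
move=> Dt; have hq := C1_is_derive C2q.1 Dt.
have hq1 := C1_is_derive C2q.2 Dt.
have /eqP := is_derive_constant Dt dot_velocity (is_derive_dot hq hq1).
by rewrite addrC addr_eq0 => /eqP.
Qed.

Hypotheses (orth : forall t, D t -> dot (q t) (om t) = 0).
Hypotheses (kin : forall t, D t -> derive1 q t = cross (om t) (q t)).

(** Only the direction is assumed to be differentiable; on D the angular velocity
    is the cross product of the direction and its derivative. *)
Lemma is_derive_angular_velocity t : D t -> is_derive t 1 om (derive1 om t).
Proof.
move=> Dt; apply: derivable_is_derive.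
have h := is_derive_cross (C1_is_derive C2q.1 Dt) (C1_is_derive C2q.2 Dt).
suff [] : is_derive t 1 om
  (cross (derive1 q t) (derive1 q t) + cross (q t) (derive1 (derive1 q) t)).
  by [].
apply: (is_derive_ext oD Dt _ h) => x Dx.
by rewrite -(angular_velocityE (Sq Dx) (orth Dx) (kin Dx)).
Qed.

Lemma dot_angular_acceleration t : D t -> dot (q t) (derive1 om t) = 0.
Proof.
move=> Dt.
have := is_derive_constant Dt orth
  (is_derive_dot (C1_is_derive C2q.1 Dt) (is_derive_angular_velocity Dt)).
by rewrite kin // [dot (cross _ _) _]dotC dot_crossl add0r.
Qed.

Lemma accelerationE t : D t -> derive1 (derive1 q) t =
  - cross (q t) (derive1 om t) - enorm (om t) ^+ 2 *: q t.
Proof.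
move=> Dt.
have h := is_derive_cross (is_derive_angular_velocity Dt)
  (C1_is_derive C2q.1 Dt).
have -> : derive1 (derive1 q) t =
    cross (derive1 om t) (q t) + cross (om t) (derive1 q t).
  apply: is_derive1E; apply: (is_derive_ext oD Dt _ h) => x Dx.
  by rewrite kin.
rewrite kin // cross_cross [dot (om t) (q t)]dotC orth // scale0r sub0r.
by rewrite enorm_sq crossC.
Qed.

(** Taking q x of [accelerationE] removes the radial term and returns om',
    which is orthogonal to q because q . om and q' . om vanish. *)
Lemma cross_acceleration t : D t ->
  cross (q t) (derive1 (derive1 q) t) = derive1 om t.
Proof.
move=> Dt; rewrite accelerationE // crossDr !crossNr crossZr crossvv scaler0.
rewrite cross_cross dot_angular_acceleration // Sq // scale0r scale1r.
by rewrite sub0r opprK oppr0 addr0.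
Qed.
End Motion.
End LinkEquations.

(** * Block matrix form *)

Section BlockSystems.
Variables (R : realType) (n : nat).

Lemma block_systemP (c : R) (r l : 'I_n -> mat3 R) (B : 'I_n -> 'I_n -> mat3 R)
    (x b0 : vec3 R) (y b : 'I_n -> vec3 R) :
  block_mx c%:M (\mxrow_j r j) (\mxcol_i l i) (\mxblock_(i, j) B i j)
    *m col_mx x (\mxcol_i y i) = col_mx b0 (\mxcol_i b i) <->
  c *: x + \sum_j r j *m y j = b0 /\
  forall i, l i *m x + \sum_j B i j *m y j = b i.
Proof.
rewrite mul_block_col mul_scalar_mx mul_mxrow_mxcol mxcol_mul mul_mxblock_mxrow.
rewrite -mxcolD; split=> [/eq_col_mx[-> /eq_mxcolP //]|[<- h]].
by congr col_mx; apply: eq_mxcol.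
Qed.

Variables (i : 'I_n) (q acc dom : 'I_n -> vec3 R) (m0 c : R) (mu N : 'I_n -> R)
  (x2 : vec3 R).

Lemma link_row :
  - (m0 *: hat (q i) ^+ 2) *m x2
    + \sum_j (if i == j then (mu i)%:M else - (mu j *: hat (q i) ^+ 2)) *m acc j
  = mu i *: acc i
    - hat (q i) ^+ 2 *m (m0 *: x2 + \sum_(j | j != i) mu j *: acc j).
Proof.
rewrite (bigD1 i) //= eqxx mul_scalar_mx mulmxDr mulmx_sumr opprD.
rewrite mulNmx -scalemxAl -scalemxAr addrCA; congr (_ + (_ + _)).
rewrite -sumrN; apply: eq_bigr => j /negPf ji.
by rewrite eq_sym ji mulNmx -scalemxAl -scalemxAr.
Qed.

(** Substituting the accelerations in q_i x (m0 x'' + sum_j mu_j q_j'' - c e3)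
    gives the difference of the two sides of the row: the diagonal term is
    exactly q_i x q_i'' = omega_i', the others produce the products of hats and
    the centripetal terms. *)
Lemma link_row_omega :
  (forall j, acc j = - cross (q j) (dom j) - N j *: q j) ->
  cross (q i) (acc i) = dom i ->
  ((m0 *: hat (q i)) *m x2
    + \sum_j (if i == j then (mu i)%:M
              else - (mu j *: (hat (q i) *m hat (q j)))) *m dom j
   = \sum_(j | j != i) (mu j * N j) *: (hat (q i) *m q j)
     + c *: (hat (q i) *m e3)) <->
  cross (q i) (m0 *: x2 + \sum_j mu j *: acc j - c *: e3) = 0.
Proof.
move=> accE qacc.
suff diffE : cross (q i) (m0 *: x2 + \sum_j mu j *: acc j - c *: e3) =
  (m0 *: hat (q i)) *m x2
  + \sum_j (if i == j then (mu i)%:M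
            else - (mu j *: (hat (q i) *m hat (q j)))) *m dom j
  - (\sum_(j | j != i) (mu j * N j) *: (hat (q i) *m q j)
     + c *: (hat (q i) *m e3)).
  by rewrite diffE; split=> [->|/eqP]; rewrite ?subrr // subr_eq0 => /eqP.
rewrite !crossDr crossNr !crossZr -scalemxAl !hatE opprD addrA.
congr (_ - _); rewrite -[RHS]addrA; congr (_ + _).
rewrite (bigD1 i) // [in RHS](bigD1 i) //= eqxx mul_scalar_mx crossDr crossZr.
rewrite qacc -addrA; congr (_ + _); rewrite cross_sumr -sumrB.
apply: eq_bigr => j /negPf ji.
rewrite eq_sym ji mulNmx -scalemxAl -mulmxA !hatE crossZr accE crossDr !crossNr.
by rewrite crossZr scalerDr !scalerN scalerA.
Qed.

Lemma translation_row_omega (y : vec3 R) :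
  (forall j, acc j = - cross (q j) (dom j) - N j *: q j) ->
  (y + \sum_j - (mu j *: hat (q j)) *m dom j
   = \sum_j (mu j * N j) *: q j + x2) <->
  y + \sum_j mu j *: acc j = x2.
Proof.
move=> accE.
have -> : \sum_j mu j *: acc j = \sum_j - (mu j *: hat (q j)) *m dom j
    - \sum_j (mu j * N j) *: q j.
  rewrite -sumrB; apply: eq_bigr => j _.
  by rewrite accE mulNmx -scalemxAl hatE scalerDr !scalerN scalerA.
split=> [h|<-]; first by rewrite addrA h addrAC subrr add0r.
by rewrite [RHS]addrC addrA subrK.
Qed.
End BlockSystems.

Theorem proposition1 (R : realType) (n : nat) (P : parameters R n)
  (symJ : (inertia P)^T = inertia P)
  (D : set R) (openD : open D)
  (t0 tf : R) (lt_t0tf : t0 < tf) (sub_D : `[t0, tf] `<=` D)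
  (f : R -> R) (contf : {in D, continuous f})
  (M : R -> 'cV[R]_3) (contM : {in D, continuous M})
  (Dx DR : 'cV[R]_3)
  (s : motion R n) (omega : 'I_n -> R -> 'cV[R]_3)
  (conf_s : on_configuration_space D s)
  (C2x : C2 D (pos s)) (C2R : C2 D (att s)) (C2q : forall i, C2 D (dir s i))
  (orth_omega : forall i t, D t -> dot (dir s i t) (omega i t) = 0)
  (kin_omega : forall i t, D t ->
     derive1 (dir s i) t = cross (omega i t) (dir s i t)) :
  let x := pos s in let Om := angvel s in let q := dir s in
  let J := inertia P in let g := gravity P in
  let Fx t := - (f t *: (att s t *m e3)) + (M00 P * g) *: e3 + Dx in
  let eq_a t :=
    M00 P *: derive1n 2 x t + \sum_i M0 P i *: derive1n 2 (q i) t = Fx t in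
  let eq_b t := forall i,
    Mij P i i *: derive1n 2 (q i) t
      - hat (q i t) ^+ 2 *m (M0 P i *: derive1n 2 x t
          + \sum_(j | j != i) Mij P i j *: derive1n 2 (q j) t)
    = - ((Mij P i i * enorm (derive1 (q i) t) ^+ 2) *: q i t)
      - (\sum_(a < n | (i <= a)%N) link_mass P a * g * link_length P i)
          *: (hat (q i t) ^+ 2 *m e3) in
  let eq_c t :=
    J *m derive1 Om t + hat (Om t) *m (J *m Om t) = M t + DR in
  let matrix_form t :=
    block_mx
      (M00 P)%:M
      (\mxrow_(j < n) (M0 P j)%:M)
      (\mxcol_(i < n) (- (M0 P i *: hat (q i t) ^+ 2)))
      (\mxblock_(i < n, j < n)
         (if i == j then (Mij P i i)%:M
         else - (Mij P i j *: hat (q i t) ^+ 2)))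
    *m col_mx (derive1n 2 x t) (\mxcol_(i < n) derive1n 2 (q i) t)
    = col_mx
        (Fx t)
        (\mxcol_(i < n)
           (- ((enorm (derive1 (q i) t) ^+ 2 * Mij P i i) *: q i t)
            - (\sum_(a < n | (i <= a)%N) link_mass P a * g * link_length P i)
                *: (hat (q i t) ^+ 2 *m e3))) in
  let matrix_form_omega t :=
    block_mx
      (M00 P)%:M
      (\mxrow_(j < n) (- (M0 P j *: hat (q j t))))
      (\mxcol_(i < n) (M0 P i *: hat (q i t)))
      (\mxblock_(i < n, j < n)
         (if i == j then (Mij P i i)%:M
         else - (Mij P i j *: (hat (q i t) *m hat (q j t)))))
    *m col_mx (derive1n 2 x t) (\mxcol_(i < n) derive1 (omega i) t)
    = col_mx
        (\sum_j (M0 P j * enorm (omega j t) ^+ 2) *: q j t + Fx t)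
        (\mxcol_(i < n)
           (\sum_(j | j != i) (Mij P i j * enorm (omega j t) ^+ 2)
                *: (hat (q i t) *m q j t)
            + (\sum_(a < n | (i <= a)%N) link_mass P a * g * link_length P i)
                *: (hat (q i t) *m e3))) in
  [/\ lagrange_dAlembert P f M Dx DR D t0 tf s <->
        (forall t, t \in `[t0, tf] -> [/\ eq_a t, eq_b t & eq_c t]),
      (forall t, t \in `[t0, tf] ->
        (eq_a t /\ eq_b t) <-> matrix_form t) &
      (forall t, t \in `[t0, tf] ->
        matrix_form t <->
        (matrix_form_omega t /\
         forall i, derive1 (q i) t = cross (omega i t) (q i t)))].
Proof.
move=> x Om q J g Fx eq_a eq_b eq_c matrix_form matrix_form_omega.
have DI t : t \in `[t0, tf] -> D t by exact: sub_D.
have qq i t : D t -> dot (q i t) (q i t) = 1.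
  by move=> Dt; have [_ /(_ i)/S2E] := conf_s _ Dt.
have aP t : eq_a t <-> pos_residual P f Dx s t = 0.
  rewrite /eq_a /pos_residual /force.
  rewrite (_ : thrust f s t + Dx + (M00 P * gravity P) *: e3 = Fx t).
    by split=> [->|/eqP]; rewrite ?subrr // subr_eq0 => /eqP.
  by rewrite /Fx /thrust -addrA [Dx + _]addrC addrA.
have bP t : D t -> eq_b t <->
    forall i, cross (q i t) (dir_residual P s i t) = 0.
  move=> Dt.
  have linkP i := link_equationP (Mij P i i) (link_weight P i)
    (M0 P i *: derive1 (derive1 x) t
     + \sum_(j | j != i) Mij P i j *: derive1 (derive1 (q j)) t)
    (qq i t Dt) (dot_acceleration openD (C2q i) (qq i) Dt).
  have resE i : dir_residual P s i t = M0 P i *: derive1 (derive1 x) t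
      + \sum_(j | j != i) Mij P i j *: derive1 (derive1 (q j)) t
      + Mij P i i *: derive1 (derive1 (q i)) t - link_weight P i *: e3.
    by rewrite /dir_residual (bigD1 i) //= [X in _ + X - _]addrC addrA.
  by split=> h i; [rewrite resE; apply/linkP/h|apply/linkP; rewrite -resE; exact: h].
have cP t : eq_c t <-> att_residual P M DR s t = 0.
  rewrite /eq_c /att_residual hatE.
  by split=> [->|/eqP]; rewrite ?subrr // subr_eq0 => /eqP.
have matrixP t : matrix_form t <-> eq_a t /\ eq_b t.
  rewrite /matrix_form block_systemP /eq_a /eq_b.
  have aE : \sum_j (M0 P j)%:M *m derive1n 2 (q j) t =
      \sum_j M0 P j *: derive1n 2 (q j) t.
    by apply: eq_bigr => j _; rewrite mul_scalar_mx.
  have rowE i := link_row i (q ^~ t) (fun j => derive1n 2 (q j) t) (M0 P i)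
    (Mij P i) (derive1n 2 x t).
  rewrite aE; split=> -[ha hb]; split=> // i; have := hb i.
    by rewrite [LHS]rowE [_ * Mij P i i]mulrC.
  by move=> hbi; rewrite [LHS]rowE [_ * Mij P i i]mulrC.
have omegaP t : D t -> matrix_form_omega t <-> eq_a t /\
    forall i, cross (q i t) (dir_residual P s i t) = 0.
  move=> Dt; rewrite /matrix_form_omega block_systemP.
  have accE j : derive1 (derive1 (q j)) t =
      - cross (q j t) (derive1 (omega j) t) - enorm (omega j t) ^+ 2 *: q j t.
    exact: (accelerationE openD (C2q j) (qq j) (orth_omega j) (kin_omega j) Dt).
  have qacc j : cross (q j t) (derive1 (derive1 (q j)) t) = derive1 (omega j) t.
    exact: (cross_acceleration openD (C2q j) (qq j) (orth_omega j)
      (kin_omega j) Dt).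
  have rowa := translation_row_omega (M0 P) (Fx t)
    (M00 P *: derive1 (derive1 x) t) accE.
  have rowb i := link_row_omega (M0 P i) (link_weight P i) (Mij P i)
    (derive1 (derive1 x) t) accE (qacc i).
  split=> -[ha hb]; split.
  - exact/rowa.
  - by move=> i; exact/(rowb i)/hb.
  - exact/rowa.
  - by move=> i; exact/(rowb i)/hb.
have lagrangeP := lagrange_dAlembertP symJ openD lt_t0tf sub_D Dx DR contf contM
  conf_s C2x C2R C2q.
split.
- split=> [/lagrangeP res0 t tI|eqs].
    have [r1 r2 r3] := res0 t tI.
    by split; [exact/aP|exact/(bP _ (DI t tI))|exact/cP].
  apply/lagrangeP => t tI; have [ea eb ec] := eqs t tI.
  by split; [exact/aP|exact/(bP _ (DI t tI))|exact/cP].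
- by move=> t _; apply: iff_sym; exact: matrixP.
- move=> t /DI Dt; split=> [/matrixP[ea /(bP _ Dt) eb]|[/(omegaP _ Dt)[ea eb] _]].
    by split; [exact/(omegaP _ Dt)|move=> i; exact: kin_omega].
  by apply/matrixP; split=> //; exact/(bP _ Dt).
Qed.
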